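(* Let $f:\mathbb R\to\mathbb R$ be continuously differentiable and consider the scalar conservation law $u_t+f(u)_x=0$. Then for every $\alpha\in\,]0,1]$ one has the inclusion $$\mathbf L^\infty(\mathbb R)\cap W^{\alpha,1}(\mathbb R)\subseteq\mathcal D_\alpha .$$
   Context: $S_t\overline u$ denotes the unique (Kruzhkov) entropy weak solution at time $t$ of $u_t+f(u)_x=0$ with initial datum $u(0,\cdot)=\overline u$. No convexity of $f$ is assumed. The intermediate domain is $$\mathcal D_\alpha=\Big\{\overline u\in\mathbf L^1(\mathbb R)\cap\mathbf L^\infty(\mathbb R):\ \sup_{0<t\le1}t^{-\alpha}\|S_t\overline u-\overline u\|_{\mathbf L^1}<+\infty\Big\}.$$ For $0<\alpha\le1$, the fractional Sobolev space is defined by $$W^{\alpha,1}(\mathbb R)=\Big\{u\in\mathbf L^1(\mathbb R):\ \frac{|u(x)-u(y)|}{|x-y|^{1+\alpha}}\in\mathbf L^1(\mathbb R\times\mathbb R)\Big\},\qquad \|u\|_{W^{\alpha,1}}=\|u\|_{\mathbf L^1}+\int_{\mathbb R\times\mathbb R}\frac{|u(x)-u(y)|}{|x-y|^{1+\alpha}}\,dx\,dy .$$ *)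

(* Defs.v *)
From mathcomp Require Import all_boot all_order all_algebra.
From mathcomp Require Import all_classical all_reals all_analysis.
Set Implicit Arguments.
Unset Strict Implicit.
Unset Printing Implicit Defensive.
Import Order.TTheory GRing.Theory Num.Theory.
Import numFieldNormedType.Exports.
Local Open Scope classical_set_scope.
Local Open Scope ring_scope.

(** Elements of L^1(R), L^oo(R) and W^{alpha,1}(R) are represented by Borel
    functions [R -> R], not by classes modulo null sets; functions of time and
    space take time first. *)

Section Spaces.
Context {R : realType}.
Notation mu := (@lebesgue_measure R).

Definition L1_Linf : set (R -> R) :=
  [set u | u \in Lfun mu 1%E /\ u \in Lfun mu +oo%E].

(** On the diagonal, a null set, the quotient is [0 / 0 = 0]. *)
Definition W1 (alpha : R) : set (R -> R) :=
  [set u | u \in Lfun mu 1%E /\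
    (mu \x mu)%E.-integrable setT
      (fun p : R * R =>
        (`|u p.1 - u p.2| / `|p.1 - p.2| `^ (1 + alpha))%:E)].

End Spaces.

Section EntropySolutions.
Context {R : realType}.
Notation mu := (@lebesgue_measure R).

Definition is_C1 (f : R -> R) : Prop :=
  (forall x, derivable f x 1) /\ continuous (derive1 f).

Definition dt (phi : R -> R -> R) (t x : R) : R := derive1 (phi ^~ x) t.
Definition dx (phi : R -> R -> R) (t x : R) : R := derive1 (phi t) x.

(** Nonnegative C^1 functions with compact support in ]0, +oo[ x R. *)
Definition test_function (phi : R -> R -> R) : Prop :=
  [/\ forall t x, derivable (phi ^~ x) t 1 /\ derivable (phi t) x 1,
      continuous (fun p : R * R => dt phi p.1 p.2),
      continuous (fun p : R * R => dx phi p.1 p.2),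
      forall t x, 0 <= phi t x &
      exists K : set (R * R), [/\ compact K, K `<=` [set p | 0 < p.1] &
        forall t x, ~ K (t, x) -> phi t x = 0]].

(** Kruzhkov entropy weak solutions of [u_t + f(u)_x = 0], [u(0,.) = ubar], in
    the class C([0,+oo[; L^1_loc) of bounded functions.  The entropy inequality
    with [k] and [- k] for [k] large contains the weak formulation. *)
Definition entropy_solution (f ubar : R -> R) (u : R -> R -> R) : Prop :=
  [/\ measurable_fun [set p : R * R | 0 <= p.1] (fun p => u p.1 p.2),
      exists M : R, {ae (mu \x mu)%E, forall p, 0 <= p.1 -> `|u p.1 p.2| <= M},
      (forall t r : R, 0 <= t ->
        (\int[mu]_(x in `[(- r)%R, r%R]) `|u s x - u t x|%:E)%E
          @[s --> within `[0, +oo[ (nbhs t)] --> 0%E),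
      {ae mu, forall x, u 0 x = ubar x} &
      forall (k : R) (phi : R -> R -> R), test_function phi ->
        (0 <= \int[(mu \x mu)]_(p in [set p : R * R | (0 < p.1)%R])
          (`|u p.1 p.2 - k| * dt phi p.1 p.2 +
           Num.sg (u p.1 p.2 - k) * (f (u p.1 p.2) - f k)
             * dx phi p.1 p.2)%:E)%E].

(** [S t ubar] is the value at time [t] of an entropy solution with datum
    [ubar]; such an [S] exists, and is unique up to null sets, by Kruzhkov's
    theorem. *)
Definition solution_operator (f : R -> R) (S : R -> (R -> R) -> R -> R) : Prop :=
  forall ubar, L1_Linf ubar -> entropy_solution f ubar (S ^~ ubar).

Definition intermediate_domain (S : R -> (R -> R) -> R -> R) (alpha : R) :
    set (R -> R) :=
  [set ubar | L1_Linf ubar /\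
    (ereal_sup [set ((t `^ (- alpha))%:E *
                     'N[mu]_1[(fun x => (S t ubar x - ubar x)%:E)])%E
               | t in [set t | (0 < t <= 1)%R] ] < +oo)%E].

End EntropySolutions.

(* Main.v *)
Require Import Defs.
From HB Require Import structures.
From mathcomp Require Import all_boot all_order all_algebra.
From mathcomp Require Import all_classical all_reals all_analysis.
From mathcomp Require Import measurable_realfun ess_sup_inf.
From mathcomp Require Import ring lra.
Set Implicit Arguments.
Unset Strict Implicit.
Unset Printing Implicit Defensive.
Import Order.TTheory GRing.Theory Num.Theory.
Import numFieldNormedType.Exports.
Local Open Scope classical_set_scope.
Local Open Scope ring_scope.

(* A solution u is compared with its datum v directly, without Kruzhkov's
   doubling of variables.  For T in ]0, 1], use the entropy inequality with the
   constant k = v(y) and the test function chi(t) eta((x - y) / T), where chi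
   approximates the indicator of [0, T], and integrate over |y| <= N.  Since the
   entropy flux q(u, k) is L-Lipschitz in k, and the integral of
   eta'((x - y) / T) over y vanishes except for |x| near N, one gets

     ||u(T) - v||_{L^1(|x| <= N - T)} <= C (T^-1 + L T T^-2) I + C L M T,

   where I, the integral of |v(x) - v(y)| over |x - y| <= T, is at most
   T^(1 + alpha) times the Slobodeckij seminorm of v, and the last term bounds
   the contribution of |x| near N.  That term does not vanish as N -> +oo, but
   T <= T^alpha.  Nothing is needed on u(t) at infinity. *)

(** The approximation [chi] is never sent to its limit. The window [d] is only taken so small that
    u(t) stays within T^alpha, in L^1 of a bounded interval, of u(0) on [d, 2d] and of u(T) on
    [T, T + d]: an error already of the order sought. This [d] depends on N through the interval,
    but it is absent from the final bound, so N can go to infinity afterwards. Constants being free,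
    the ramps chi' needs only have mass between 1/8 and 4. The width T of the kernel is the balance
    point: a width h gives h^alpha for the two time terms and L T h^(alpha - 1) for the flux, while
    the term near |x| = N is of order L M T for every h. Integrating the entropy inequality in y
    requires Fubini, hence an integrand bounded with bounded support. Bounds in L^oo hold only
    almost everywhere, so the datum and the solution are first clamped; the datum clamped in this
    way has no larger increments, and its seminorm is controlled by the original one. *)

Section bump.
Context {R : realType}.
Implicit Types (x y z : R).

(** Squaring removes the kink of the positive part, so all cut-offs below are squares of positive
    parts of polynomials: C^1 is all that [test_function] asks for. *)
Lemma is_derive_sqr_pos z :
  is_derive z 1 (fun z : R => Num.max 0 z ^+ 2) (2 * Num.max 0 z).
Proof.
have dX (x : R) : is_derive x 1 (fun z : R => z ^+ 2) (2 * x).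
  by apply: is_derive_eq; rewrite /GRing.scale/=; ring.
have [z0|z0|z0] := ltgtP 0 z.
- apply: (near_eq_is_derive _ (dX z)).
  near=> y; congr (_ ^+ 2); apply/esym/max_idPr/ltW.
  by near: y; exact: lt_nbhsr.
- rewrite mulr0.
  apply: (@near_eq_is_derive _ _ _ (cst 0)).
  near=> y; rewrite /cst/=.
  have -> : Num.max 0 y = 0.
    apply/max_idPl/ltW; by near: y; exact: lt_nbhsl.
  by rewrite expr0n.
- rewrite -z0 mulr0.
  (* At the kink the difference quotient is h or 0, hence at most |h| in absolute value. *)
  have H : h^-1 *: ((fun z : R => Num.max 0 z ^+ 2) (h *: 1 + 0) - Num.max 0 0 ^+ 2) @[h --> 0^'] --> (0:R).
    apply/cvgrPdist_le => e e0; near=> h.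
    have h0 : h != 0 by near: h; exact: nbhs_dnbhs_neq.
    have he : `|h| <= e by near: h; exact: dnbhs0_le.
    rewrite maxxx expr0n subr0 addr0 sub0r normrN /GRing.scale/= mulr1.
    apply: le_trans he; case: (leP 0 h) => h1.
      by rewrite expr2 mulrA mulVf// mul1r.
    by rewrite expr0n mulr0 normr0.
  apply: DeriveDef; first by apply/cvg_ex; exists 0.
  exact: cvg_lim H.
Unshelve. all: by end_near.
Qed.

Definition eta z : R := Num.max 0 (1 - z ^+ 2) ^+ 2.
Definition deta z : R := - 4 * z * Num.max 0 (1 - z ^+ 2).

Lemma is_derive_eta z : is_derive z 1 eta (deta z).
Proof.
have dX (x : R) : is_derive x 1 (fun z : R => z ^+ 2) (2 * x).
  by apply: is_derive_eq; rewrite /GRing.scale/=; ring.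
have H : is_derive z 1 (fun z : R => 1 - z ^+ 2) (- (2 * z)).
  by apply: is_derive_eq; rewrite /GRing.scale/=; ring.
have := @is_derive1_comp _ _ (fun z : R => 1 - z ^+ 2) z _ _ (is_derive_sqr_pos _) H.
rewrite [X in is_derive _ _ X _](_ : _ = eta)//.
move=> H'; apply: (@is_derive_eq _ _ _ _ _ _ _ _ H'); rewrite /deta; ring.
Qed.

Lemma continuous_pos : continuous (fun z : R => Num.max 0 z).
Proof. move=> x; apply: (@continuous_max _ _ (cst 0) id); [exact: cvg_cst|exact: cvg_id]. Qed.

Lemma continuous_eta : continuous eta.
Proof.
move=> x.
have [/derivable1_diffP/differentiable_continuous] := is_derive_eta x.
done.
Qed.

Lemma continuous_deta : continuous deta.
Proof.
move=> x; apply: cvgM; first by apply: cvgM; [exact: cvg_cst|exact: cvg_id].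
apply: (@continuous_comp _ _ _ (fun z : R => 1 - z ^+ 2) (fun z : R => Num.max 0 z) x); last exact: continuous_pos.
by apply: cvgB; [exact: cvg_cst|exact: exprn_continuous].
Qed.

Lemma eta_ge0 z : 0 <= eta z. Proof. exact: sqr_ge0. Qed.

Lemma eta_eq0 z : 1 <= `|z| -> eta z = 0.
Proof.
move=> z1; rewrite /eta (max_idPl _) ?expr0n// subr_le0 -[z ^+ 2]real_normK ?num_real//.
by rewrite exprn_ege1.
Qed.

Lemma deta_eq0 z : 1 <= `|z| -> deta z = 0.
Proof.
move=> z1; rewrite /deta (max_idPl _) ?mulr0// subr_le0 -[z ^+ 2]real_normK ?num_real//.
by rewrite exprn_ege1.
Qed.

Lemma eta_le1 z : eta z <= 1.
Proof.
have : 0 <= Num.max 0 (1 - z ^+ 2) <= 1.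
  by rewrite le_max lexx ge_max ler01 /= gerBl sqr_ge0.
by rewrite /eta => /andP[? ?]; rewrite exprn_ile1.
Qed.

Lemma norm_deta_le z : `|deta z| <= 4.
Proof.
have [z1|z1] := leP 1 `|z|; first by rewrite deta_eq0 ?normr0.
have : 0 <= Num.max 0 (1 - z ^+ 2) <= 1.
  by rewrite le_max lexx ge_max ler01 /= gerBl sqr_ge0.
move=> /andP[m0 m1]; rewrite !normrM normrN (ger0_norm m0) (@ger0_norm _ 4)//.
nra.
Qed.

(** Keeps the kernel away from 0 on half of its support; the lower bound on [mass] rests on this. *)
Lemma eta_ge z : `|z| <= 1 / 2 -> 1 / 2 <= eta z.
Proof.
move=> z1; have : z ^+ 2 <= (1 / 2) ^+ 2.
  by rewrite -[z ^+ 2]real_normK ?num_real//; apply: lerXn2r; rewrite ?nnegrE//; lra.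
rewrite /eta => z2.
have z3 : 3 / 4 <= 1 - z ^+ 2 by lra.
rewrite (max_idPr _); last lra.
have := sqr_ge0 (1 - z ^+ 2 - 3 / 4); nra.
Qed.

(** Flattening [eta] on the left of its maximum gives a C^1 step, 1 for z <= 0 and 0 for z >= 1. *)
Definition etap z : R := eta (Num.max 0 z).
Definition detap z : R := deta (Num.max 0 z).

(** The inner positive part is not differentiable at 0, but [etap] depends on it only through its
    square. *)
Lemma is_derive_etap z : is_derive z 1 etap (detap z).
Proof.
have H : is_derive z 1 (fun z : R => 1 - Num.max 0 z ^+ 2) (- (2 * Num.max 0 z)).
  have H := is_deriveB (is_derive_cst (1 : R) z 1) (is_derive_sqr_pos z).
  by apply: (@is_derive_eq _ _ _ _ _ _ _ _ H); rewrite sub0r.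
have := @is_derive1_comp _ _ (fun z : R => 1 - Num.max 0 z ^+ 2) z _ _ (is_derive_sqr_pos _) H.
move=> H'; apply: (@is_derive_eq _ _ _ _ _ _ _ _ H'); rewrite /detap /deta; ring.
Qed.

Lemma continuous_detap : continuous detap.
Proof.
by move=> x; apply: (@continuous_comp _ _ _ (fun z : R => Num.max 0 z) deta); [exact: continuous_pos|exact: continuous_deta].
Qed.

Lemma etap_ge0 z : 0 <= etap z. Proof. exact: eta_ge0. Qed.

Lemma etap_le1 z : etap z <= 1. Proof. exact: eta_le1. Qed.

Lemma etap_eq1 z : z <= 0 -> etap z = 1.
Proof.
by move=> z0; rewrite /etap /eta (max_idPl z0) expr0n subr0 (max_idPr _)// expr1n.
Qed.

Lemma etap_eq0 z : 1 <= z -> etap z = 0.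
Proof.
by move=> z1; apply: eta_eq0; rewrite (max_idPr _) ?ger0_norm// (le_trans _ z1).
Qed.

Lemma etap_le x y : x <= y -> etap y <= etap x.
Proof.
have pos_ge0 (a : R) : 0 <= Num.max 0 a by rewrite le_max lexx.
move=> xy; apply: lerXn2r; rewrite ?nnegrE//.
by rewrite le_max2// lerB// lerXn2r ?nnegrE// le_max2.
Qed.

Lemma detap_le0 z : detap z <= 0.
Proof.
rewrite /detap /deta; set a := Num.max 0 z; set b := Num.max 0 _.
have a0 : 0 <= a by rewrite le_max lexx.
have b0 : 0 <= b by rewrite le_max lexx.
nra.
Qed.

Lemma norm_detap_le z : `|detap z| <= 4. Proof. exact: norm_deta_le. Qed.

Lemma detap_eq0 z : z <= 0 \/ 1 <= z -> detap z = 0.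
Proof.
move=> [z0|z1]; first by rewrite /detap /deta (max_idPl z0) mulr0 mul0r.
by apply: deta_eq0; rewrite (max_idPr _) ?ger0_norm// (le_trans _ z1).
Qed.

(** A slope bounded away from 0 on the middle half of the transition makes the mass of a ramp at
    least 1/4 * 1/2. *)
Lemma detap_le z : 1 / 4 <= z <= 3 / 4 -> detap z <= - (1 / 4).
Proof.
move=> /andP[z1 z2]; rewrite /detap /deta (max_idPr _); last lra.
have z3 : z ^+ 2 <= 9 / 16.
  rewrite expr2; nra.
rewrite (max_idPr _); [nra|lra].
Qed.

End bump.

(** * Test functions: a plateau in time multiplied by a kernel in space *)

Section test_functions.
Context {R : realType}.
Implicit Types (T d h t x y : R).

Lemma is_derive_rescale (g : R -> R) (a b h x : R) :
  is_derive ((x - a) / h) 1 g b ->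
  is_derive x 1 (fun x => g ((x - a) / h)) (b / h).
Proof.
move=> gb.
have H : is_derive x 1 (fun x : R => (x - a) / h) h^-1.
  by apply: is_derive_eq; rewrite /GRing.scale/= mulr0 add0r; ring.
exact: (@is_derive1_comp _ _ (fun x : R => (x - a) / h) x _ _ gb H).
Qed.

Lemma continuous_rescale (g : R -> R) (a h : R) :
  continuous g -> continuous (fun x => g ((x - a) / h)).
Proof.
move=> cg x; apply: (@continuous_comp _ _ _ (fun x => (x - a) / h) g); last exact: cg.
by apply: cvgM; [apply: cvgB; [exact: cvg_id|exact: cvg_cst]|exact: cvg_cst].
Qed.

(** The function [chi]: it rises on [d, 2d] and falls on [T, T + d]. Starting the rise at d rather
    than 0 keeps the support inside t > 0. *)
Definition plateau T d t : R := etap ((t - T) / d) - etap ((t - d) / d).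
Definition dplateau T d t : R := detap ((t - T) / d) / d - detap ((t - d) / d) / d.

Lemma is_derive_plateau T d t : is_derive t 1 (plateau T d) (dplateau T d t).
Proof.
by apply: is_deriveB; apply: is_derive_rescale; exact: is_derive_etap.
Qed.

Lemma continuous_dplateau T d : continuous (dplateau T d).
Proof.
move=> t; apply: cvgB; apply: cvgM; try exact: cvg_cst;
  by apply: continuous_rescale; exact: continuous_detap.
Qed.

Lemma plateau_itv T d t : 0 < d -> d <= T -> 0 <= plateau T d t <= 1.
Proof.
move=> d0 dT; rewrite /plateau.
have := @etap_le _ ((t - T) / d) ((t - d) / d).
rewrite ler_pM2r ?invr_gt0// lerB// => /(_ isT).
have := etap_ge0 ((t - d) / d); have := etap_le1 ((t - T) / d); lra.
Qed.

Lemma plateau_eq0 T d t : 0 < d -> d <= T -> t <= d \/ T + d <= t ->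
  plateau T d t = 0.
Proof.
move=> d0 dT [td|Tt]; rewrite /plateau.
  by rewrite !etap_eq1 ?subrr// pmulr_lle0 ?invr_gt0//; lra.
by rewrite !etap_eq0 ?subrr// ler_pdivlMr//; lra.
Qed.

Lemma dplateau_eq0 T d t : 0 < d -> d <= T -> t <= d \/ T + d <= t ->
  dplateau T d t = 0.
Proof.
move=> d0 dT [td|Tt]; rewrite /dplateau.
  by rewrite !detap_eq0 ?mul0r ?subrr//; left; rewrite pmulr_lle0 ?invr_gt0//; lra.
by rewrite !detap_eq0 ?mul0r ?subrr//; right; rewrite ler_pdivlMr//; lra.
Qed.

Lemma eta_rescale_eq0 h x y : 0 < h -> h <= `|x - y| -> eta ((x - y) / h) = 0.
Proof.
by move=> h0 hxy; apply: eta_eq0; rewrite normrM normfV (gtr0_norm h0) ler_pdivlMr// mul1r.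
Qed.

Lemma deta_rescale_eq0 h x y : 0 < h -> h <= `|x - y| -> deta ((x - y) / h) = 0.
Proof.
by move=> h0 hxy; apply: deta_eq0; rewrite normrM normfV (gtr0_norm h0) ler_pdivlMr// mul1r.
Qed.

Definition phi T d h y t x : R := plateau T d t * eta ((x - y) / h).

Lemma is_derive_phit T d h y t x :
  is_derive t 1 ((phi T d h y) ^~ x) (dplateau T d t * eta ((x - y) / h)).
Proof.
have H := is_deriveM (is_derive_plateau T d t) (is_derive_cst (eta ((x - y) / h)) t 1).
by apply: (@is_derive_eq _ _ _ _ _ _ _ _ H); rewrite /GRing.scale/=; ring.
Qed.

Lemma is_derive_phix T d h y t x :
  is_derive x 1 (phi T d h y t) (plateau T d t * (deta ((x - y) / h) / h)).
Proof.
have H := is_deriveM (is_derive_cst (plateau T d t) x 1)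
  (is_derive_rescale (is_derive_eta ((x - y) / h))).
by apply: (@is_derive_eq _ _ _ _ _ _ _ _ H); rewrite /GRing.scale/=; ring.
Qed.

Lemma dt_phi T d h y t x :
  dt (phi T d h y) t x = dplateau T d t * eta ((x - y) / h).
Proof. by rewrite /dt derive1E; have [_ ->] := is_derive_phit T d h y t x. Qed.

Lemma dx_phi T d h y t x :
  dx (phi T d h y) t x = plateau T d t * (deta ((x - y) / h) / h).
Proof. by rewrite /dx derive1E; have [_ ->] := is_derive_phix T d h y t x. Qed.

Lemma test_function_phi T d h y : 0 < d -> d <= T -> 0 < h ->
  test_function (phi T d h y).
Proof.
move=> d0 dT h0.
have ceta := @continuous_rescale eta y h (@continuous_eta R).
have cdeta := @continuous_rescale deta y h (@continuous_deta R).
have cfst (g : R -> R) : continuous g -> continuous (fun p : R * R => g p.1).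
  by move=> cg p; apply: (@continuous_comp _ _ _ fst g); [exact: cvg_fst|exact: cg].
have csnd (g : R -> R) : continuous g -> continuous (fun p : R * R => g p.2).
  by move=> cg p; apply: (@continuous_comp _ _ _ snd g); [exact: cvg_snd|exact: cg].
have cplateau : continuous (plateau T d).
  by move=> t; have [/derivable1_diffP/differentiable_continuous] := is_derive_plateau T d t.
split.
- by move=> t x; split; [have [] := is_derive_phit T d h y t x|have [] := is_derive_phix T d h y t x].
- under eq_fun do rewrite dt_phi.
  by move=> p; apply: cvgM; [exact: (cfst (dplateau T d) (@continuous_dplateau T d) p)|exact: (csnd _ ceta p)].
- under eq_fun do rewrite dx_phi.
  move=> p; apply: cvgM; first exact: (cfst _ cplateau p).
  by apply: cvgM; [exact: (csnd _ cdeta p)|exact: cvg_cst].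
- by move=> t x; rewrite mulr_ge0 ?eta_ge0//; have /andP[] := plateau_itv t d0 dT.
- exists (`[d, T + d]%classic `*` `[y - h, y + h]%classic); split.
  + by apply: compact_setX; exact: segment_compact.
  + by move=> [t x] [/=]; rewrite !in_itv/= => /andP[dt _] _; exact: lt_le_trans dt.
  + move=> t x /= /not_andP[]; rewrite !in_itv/= => /negP; rewrite negb_and -!ltNge => /orP[] H.
    * by rewrite /phi plateau_eq0 ?mul0r//; left; exact: ltW.
    * by rewrite /phi plateau_eq0 ?mul0r//; right; exact: ltW.
    * by rewrite /phi eta_rescale_eq0 ?mulr0// ler0_norm; lra.
    * by rewrite /phi eta_rescale_eq0 ?mulr0// ger0_norm; lra.
Qed.

End test_functions.

(** * Lipschitz bounds for the Kruzhkov entropy flux *)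

Section entropy_flux.
Context {R : realType}.
Implicit Types (f : R -> R) (k v M L : R).

Definition eflux f v k : R := Num.sg (v - k) * (f v - f k).

(** Without the sign function, measurability is immediate and the Lipschitz bound reduces to
    cases. *)
Lemma efluxE f v k : eflux f v k = f (Num.max v k) - f (Num.min v k).
Proof.
rewrite /eflux; case: (ltgtP v k) => [vk|vk|->].
- by rewrite ltr0_sg ?subr_lt0// mulN1r opprB.
- by rewrite gtr0_sg ?subr_gt0// mul1r.
- by rewrite !subrr mulr0.
Qed.

Lemma C1_lipschitz f M : is_C1 f -> exists2 L, 0 <= L &
  forall x y, `|x| <= M -> `|y| <= M -> `|f x - f y| <= L * `|x - y|.
Proof.
move=> [df cf].
have [M0|M0] := ltP M 0.
  by exists 0 => // x y xM; have := le_lt_trans xM M0; rewrite normr_lt0.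
have MM : - M <= M by lra.
have cnf : continuous (fun x => `|derive1 f x|).
  by move=> x; apply: (@continuous_comp _ _ _ (derive1 f) Num.norm); [exact: cf|exact: norm_continuous].
have [c _ cmax] := EVT_max MM (continuous_subspaceT cnf).
exists `|derive1 f c| => //.
have W x y : x <= y -> `|x| <= M -> `|y| <= M ->
    `|f x - f y| <= `|derive1 f c| * `|x - y|.
  move=> xy xM yM.
  have fd z : z \in `]x, y[ -> is_derive z 1 f (derive1 f z).
    by move=> _; rewrite derive1E; exact: derivableP.
  have cfxy : {within `[x, y], continuous f}.
    by apply: continuous_subspaceT => z; exact/differentiable_continuous/derivable1_diffP.
  have [z zxy fxy] := MVT_segment xy fd cfxy.
  rewrite distrC fxy normrM (distrC x) ler_wpM2r//; apply: cmax.
  move: zxy xM yM; rewrite !in_itv/= !ler_norml; lra.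
move=> x y xM yM; case: (leP x y) => [xy|/ltW yx]; first exact: W.
by rewrite distrC (distrC x); exact: W.
Qed.

(** When v separates k and k', the difference is bounded by L (|k - v| + |v - k'|), and the two
    distances add up to |k - k'|. Otherwise it is f k - f k' up to sign. *)
Lemma eflux_lipschitz f M L :
  (forall x y, `|x| <= M -> `|y| <= M -> `|f x - f y| <= L * `|x - y|) ->
  forall v k k', `|v| <= M -> `|k| <= M -> `|k'| <= M ->
    `|eflux f v k - eflux f v k'| <= L * `|k - k'|.
Proof.
move=> fL v k k' vM kM k'M.
have := fL _ _ vM kM; have := fL _ _ vM k'M; have := fL _ _ kM k'M.
rewrite !efluxE; case: (leP v k) => vk; case: (leP v k') => vk'.
- by move=> H _ _; rewrite (_ : _ - _ = f k - f k')//; ring.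
- move=> _; rewrite (ler0_norm (_ : v - k <= 0)) ?subr_le0//.
  rewrite (gtr0_norm (_ : 0 < v - k')) ?subr_gt0//.
  rewrite (gtr0_norm (_ : 0 < k - k')) ?subr_gt0 ?(lt_le_trans vk')//.
  rewrite !ler_norml; lra.
- move=> _; rewrite (gtr0_norm (_ : 0 < v - k)) ?subr_gt0//.
  rewrite (ler0_norm (_ : v - k' <= 0)) ?subr_le0//.
  rewrite (ltr0_norm (_ : k - k' < 0)) ?subr_lt0 ?(lt_le_trans vk)//.
  rewrite !ler_norml; lra.
- by move=> H _ _; rewrite (_ : _ - _ = - (f k - f k')) ?normrN//; ring.
Qed.

Lemma norm_eflux f M L :
  (forall x y, `|x| <= M -> `|y| <= M -> `|f x - f y| <= L * `|x - y|) ->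
  forall v k, `|v| <= M -> `|k| <= M -> `|eflux f v k| <= L * `|v - k|.
Proof.
move=> fL v k vM kM; apply: le_trans (fL _ _ vM kM); rewrite /eflux normrM.
by rewrite ler_piMl// normr_sg; case: (_ != _).
Qed.

End entropy_flux.

(** * Integrating an inequality that contains a signed term *)

Section integration_lemmas.
Local Open Scope ereal_scope.

Lemma integrable_bounded_support d (T : measurableType d) (R : realType)
    (mu : {measure set T -> \bar R}) (A : set T) (C : R) (f : T -> R) :
  measurable A -> mu A < +oo -> measurable_fun setT f ->
  (forall x, `|f x| <= C)%R -> (forall x, ~ A x -> f x = 0%R) ->
  mu.-integrable setT (EFin \o f).
Proof.
move=> mA Afin mf fC fA.
have -> : EFin \o f = (EFin \o f) \_ A.
  apply/funext => x; rewrite patchE; case: ifPn => // /negP xA.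
  by rewrite /= fA// => Ax; apply: xA; rewrite inE.
apply/(integrable_mkcond _ mA).
apply: measurable_bounded_integrable => //; first exact: measurable_funTS.
exists C; split; first exact: num_real.
by move=> z Cz x _ /=; rewrite (le_trans (fC x))// ltW.
Qed.

(** [H1] and [H2] may have infinite integrals, so [g] is split to keep every term nonnegative: H2 +
    g^+ <= H1 + g^-. The integrals of g^+ and g^- are finite, and the second is at most the
    first. *)
Lemma le_integral_ge0_compensated d (T : measurableType d) (R : realType)
    (mu : {measure set T -> \bar R}) (g H1 H2 : T -> \bar R) :
  mu.-integrable setT g -> 0 <= \int[mu]_x g x ->
  measurable_fun setT H1 -> measurable_fun setT H2 ->
  (forall x, 0 <= H1 x) -> (forall x, 0 <= H2 x) ->
  {ae mu, forall x, H2 x + g x <= H1 x} ->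
  \int[mu]_x H2 x <= \int[mu]_x H1 x.
Proof.
move=> ig g0 mH1 mH2 H10 H20 gH.
have mg := measurable_int _ ig.
have mgp := measurable_funepos mg.
have mgn := measurable_funeneg mg.
have H : \int[mu]_x (H2 x + g^\+ x) <= \int[mu]_x (H1 x + g^\- x).
  apply: ae_ge0_le_integral => //.
  - by move=> x _; rewrite adde_ge0.
  - exact: emeasurable_funD.
  - by move=> x _; rewrite adde_ge0.
  - exact: emeasurable_funD.
  - apply: filterS gH => x gHx _.
    have H1x : H1 x != -oo by rewrite gt_eqF// (lt_le_trans _ (H10 x)).
    have H2x : H2 x != -oo by rewrite gt_eqF// (lt_le_trans _ (H20 x)).
    (* The values +oo and -oo of [g x] force H1 x = +oo and g^- x = +oo respectively. *)
    rewrite funeposE funenegE; move: gHx; case: (g x) => [r| |].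
    + have [r0|r0] := leP 0%R r.
        rewrite (max_idPl _) ?lee_fin// (max_idPr _) ?adde0//.
        by rewrite -EFinN lee_fin oppr_le0.
      rewrite (max_idPr _) ?lee_fin ?(ltW r0)// (max_idPl _) ?adde0; last first.
        by rewrite -EFinN lee_fin oppr_ge0 ltW.
      by rewrite leeBrDr.
    + by rewrite (addey H2x) leye_eq => /eqP ->; rewrite (max_idPr _) ?leNye// adde0 leey.
    + by move=> _; rewrite [X in _ <= H1 x + X](max_idPl _) ?leey// (addey H1x) leey.
move: H; rewrite !ge0_integralD// => H.
have gp : \int[mu]_x g^\+ x \is a fin_num by exact: integrable_pos_fin_num.
have gn : \int[mu]_x g^\- x \is a fin_num by exact: integrable_neg_fin_num.
move: g0; rewrite integralE sube_ge0 ?gn ?orbT// => g0.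
rewrite -(leeD2rE _ _ gp); apply: le_trans H _.
by rewrite leeD2l.
Qed.

(** For each fixed y the hypothesis will be the entropy inequality with constant [w y]. *)
Lemma fubini_integral_ge0 d1 d2 (T1 : measurableType d1) (T2 : measurableType d2)
    (R : realType) (m1 : {sigma_finite_measure set T1 -> \bar R})
    (m2 : {sigma_finite_measure set T2 -> \bar R}) (G : T1 * T2 -> \bar R) :
  (m1 \x m2).-integrable setT G ->
  (forall y, 0 <= \int[m1]_x G (x, y)) ->
  0 <= \int[m1]_x \int[m2]_y G (x, y).
Proof.
move=> iG G0; rewrite (Fubini iG); exact: integral_ge0.
Qed.

End integration_lemmas.

Section measurability.
Context {R : realType}.

Lemma measurable_eta : measurable_fun setT (@eta R).
Proof. by apply: continuous_measurable_fun; exact: continuous_eta. Qed.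

Lemma measurable_deta : measurable_fun setT (@deta R).
Proof. by apply: continuous_measurable_fun; exact: continuous_deta. Qed.

Lemma continuous_plateau (T d : R) : continuous (plateau T d).
Proof.
by move=> t; have [/derivable1_diffP/differentiable_continuous] := is_derive_plateau T d t.
Qed.

Lemma measurable_plateau (T d : R) : measurable_fun setT (plateau T d).
Proof. by apply: continuous_measurable_fun; exact: continuous_plateau. Qed.

Lemma measurable_dplateau (T d : R) : measurable_fun setT (dplateau T d).
Proof. by apply: continuous_measurable_fun; exact: continuous_dplateau. Qed.

Lemma measurable_eflux d (T : measurableType d) (f : R -> R) (v k : T -> R) :
  measurable_fun setT f -> measurable_fun setT v -> measurable_fun setT k ->
  measurable_fun setT (fun x => eflux f (v x) (k x)).
Proof.
move=> mf mv mk; under eq_fun do rewrite efluxE.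
apply: measurable_funB; apply: measurableT_comp => //.
- exact: measurable_maxr.
- exact: measurable_minr.
Qed.

Definition near_diag (h x y : R) : R := \1_(`[- h, h]%classic) (x - y).

Lemma measurable_near_diag d (T : measurableType d) (h : R) (u v : T -> R) :
  measurable_fun setT u -> measurable_fun setT v ->
  measurable_fun setT (fun x => near_diag h (u x) (v x)).
Proof.
move=> mu mv; apply: (measurableT_comp (measurable_indic _)) => //.
exact: measurable_funB.
Qed.

Lemma near_diagE (h x y : R) : near_diag h x y = (`|x - y| <= h)%R%:R.
Proof. by rewrite /near_diag indicE mem_setE in_itv/= ler_norml. Qed.

End measurability.

(** * The pointwise inequality behind the estimate *)

Section pointwise.
Context {R : realType}.
Notation mu := (@lebesgue_measure R).

(** To be read with v = u(t,x), b = u(T,x), e and de the kernel and its x-derivative, th1 and th2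
    the rising and falling parts of chi'. Every [wy] is traded for [wx] at a cost proportional to
    |wx - wy|. The flux at [wx] is kept with its sign because its integral in y reduces to boundary
    values. *)
Lemma kruzhkov_integrand_le (f : R -> R) (M L K : R)
    (th1 th2 ch e de v wx wy b : R) :
  (forall x y, `|x| <= M -> `|y| <= M -> `|f x - f y| <= L * `|x - y|) ->
  `|v| <= M -> `|wx| <= M -> `|wy| <= M ->
  0 <= th1 -> 0 <= th2 -> 0 <= ch -> 0 <= e <= 1 -> `|de| <= K ->
  `|v - wy| * ((th1 - th2) * e) + eflux f v wy * (ch * de) <=
  (th1 * `|v - wx| + th2 * (`|v - b| - `|b - wx|)) * e +
  (th1 + th2 + ch * (L * K)) * `|wx - wy| + ch * eflux f v wx * de.
Proof.
move=> fL vM wxM wyM th10 th20 ch0 /andP[e0 e1] deK.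
have q := eflux_lipschitz fL vM wyM wxM.
have t1 : `|v - wy| <= `|v - wx| + `|wx - wy| by rewrite -[v - wy](subrKA wx) ler_normD.
have t2 : `|b - wx| <= `|v - b| + `|v - wy| + `|wx - wy|.
  rewrite (_ : b - wx = - (v - b) + (v - wy) - (wx - wy)); last by ring.
  by rewrite (le_trans (ler_normB _ _))// lerD2r (le_trans (ler_normD _ _))// normrN.
have H1 : th1 * e * `|v - wy| <= th1 * e * `|v - wx| + th1 * `|wx - wy|.
  rewrite (le_trans (ler_wpM2l _ t1)) ?mulr_ge0// mulrDr lerD2l.
  by rewrite ler_wpM2r// ler_piMr.
have H2 : th2 * e * `|b - wx| <= th2 * e * (`|v - b| + `|v - wy|) + th2 * `|wx - wy|.
  rewrite (le_trans (ler_wpM2l _ t2)) ?mulr_ge0// mulrDr lerD2l.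
  by rewrite ler_wpM2r// ler_piMr.
have H3 : (eflux f v wy - eflux f v wx) * de <= L * `|wx - wy| * K.
  rewrite (le_trans (ler_norm _))// normrM ler_pM//.
  by rewrite (distrC wx).
have H4 := ler_wpM2l ch0 H3.
lra.
Qed.

End pointwise.

(** * Averages of the kernel over |y| <= N *)

Section averages.
Context {R : realType}.
Notation mu := (@lebesgue_measure R).
Implicit Types (w : R -> R) (h N x y : R).

Definition box N y : R := \1_(`[- N, N]%classic) y.

Lemma boxE N y : box N y = (`|y| <= N)%R%:R.
Proof. by rewrite /box indicE mem_setE in_itv/= ler_norml. Qed.

Lemma box_ge0 N y : 0 <= box N y.
Proof. by rewrite boxE ler0n. Qed.

Lemma measurable_box N : measurable_fun setT (box N).
Proof. exact: measurable_indic. Qed.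

Lemma integrable_box_mul N (C : R) (g : R -> R) : measurable_fun setT g ->
  (forall y, `|g y| <= C) -> mu.-integrable setT (EFin \o (fun y => g y * box N y)).
Proof.
move=> mg gC; apply: (@integrable_bounded_support _ _ _ mu `[- N, N]%classic C) => //.
- by rewrite /= lebesgue_measure_itv; case: ifP => // _; rewrite -EFinB ltry.
- by apply: measurable_funM => //; exact: measurable_box.
- move=> y; rewrite boxE normrM; case: (_ <= N); rewrite ?normr1 ?mulr1// normr0 mulr0.
  exact: le_trans (gC y).
- by move=> y; rewrite /= in_itv/= => /negP; rewrite boxE -ler_norml => /negbTE ->; rewrite mulr0.
Qed.

Lemma measurable_rescale (g : R -> R) h d (T : measurableType d) (u v : T -> R) :
  measurable_fun setT g -> measurable_fun setT u -> measurable_fun setT v ->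
  measurable_fun setT (fun z => g ((u z - v z) / h)).
Proof.
move=> mg mu mv; apply: measurableT_comp => //.
by apply: measurable_funM => //; exact: measurable_funB.
Qed.

Lemma integral_near_diag h x : 0 <= h ->
  (\int[mu]_y (near_diag h x y)%:E = (2 * h)%:E)%E.
Proof.
move=> h0.
under eq_integral => y _.
  rewrite (_ : near_diag h x y = \1_(`[x - h, x + h]%classic) y); last first.
    rewrite /near_diag !indicE !mem_setE !in_itv/=; congr (_%:R).
    by congr nat_of_bool; apply/idP/idP => /andP[? ?]; apply/andP; split; lra.
  over.
rewrite integral_indic// setIT /= lebesgue_measure_itv/= lte_fin.
case: ifPn => [_|]; first by rewrite -EFinB; congr (_%:E); ring.
by rewrite -leNgt => H; congr (_%:E); lra.
Qed.

Lemma eta_near_diag h x y : 0 < h -> eta ((x - y) / h) <= near_diag h x y.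
Proof.
move=> h0; rewrite near_diagE; case: (leP `|x - y| h) => [_|/ltW H]; first exact: eta_le1.
by rewrite eta_rescale_eq0.
Qed.

(** The weight left on x after integration in y: comparable to h for |x| <= N - h, zero for |x| > N
    + h. *)
Definition mass h N x : R := \int[mu]_y (eta ((x - y) / h) * box N y).

Definition osc w h N x : R := \int[mu]_y (`|w x - w y| * near_diag h x y * box N y).

Lemma integrable_eta_box h N x :
  mu.-integrable setT (EFin \o (fun y => eta ((x - y) / h) * box N y)).
Proof.
apply: (@integrable_box_mul _ 1).
  by apply: measurable_rescale => //; exact: measurable_eta.
by move=> y; rewrite ger0_norm ?eta_ge0// eta_le1.
Qed.

Lemma EFin_mass h N x :
  (mass h N x)%:E = (\int[mu]_y (eta ((x - y) / h) * box N y)%:E)%E.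
Proof. by rewrite /mass /Rintegral fineK// integrable_fin_num//; exact: integrable_eta_box. Qed.

Lemma mass_ge0 h N x : 0 <= mass h N x.
Proof. by apply: Rintegral_ge0 => y _; rewrite mulr_ge0 ?eta_ge0 ?box_ge0. Qed.

Lemma mass_le h N x : 0 < h -> mass h N x <= 2 * h * box (N + h) x.
Proof.
move=> h0; rewrite -lee_fin EFin_mass boxE; case: (leP `|x| (N + h)) => H.
  rewrite mulr1 -(integral_near_diag x); last exact: ltW.
  apply: ge0_le_integral => //.
  - by move=> y _; rewrite lee_fin mulr_ge0 ?eta_ge0 ?box_ge0.
  - exact: measurable_int (integrable_eta_box h N x).
  - by apply/measurable_EFinP; exact: measurable_near_diag.
  - move=> y _; rewrite lee_fin (le_trans _ (eta_near_diag _ _ h0))//.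
    by rewrite ler_piMr ?eta_ge0// boxE; case: (_ <= N).
rewrite mulr0 integral0_eq// => y _; rewrite boxE; case: (leP `|y| N) => Hy; last by rewrite mulr0.
rewrite eta_rescale_eq0 ?mul0r//.
have := ler_normD (x - y) y; rewrite subrK; lra.
Qed.

(** The points with |x - y| <= h / 2 form an interval of length h inside the box, and the kernel is
    at least 1/2 there. *)
Lemma mass_ge h N x : 0 < h -> `|x| <= N - h -> h / 2 <= mass h N x.
Proof.
move=> h0 xN; rewrite -lee_fin EFin_mass.
rewrite (_ : h / 2 = 1 / 2 * (2 * (h / 2))); last by field.
have h20 : 0 <= h / 2 by rewrite divr_ge0// ltW.
rewrite EFinM -(@integral_near_diag (h / 2) x)// -ge0_integralZl_EFin//; last 2 first.
  by move=> y _; rewrite lee_fin near_diagE ler0n.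
  by apply/measurable_EFinP; exact: measurable_near_diag.
apply: ge0_le_integral => //.
- by move=> y _; rewrite -EFinM lee_fin near_diagE mulr_ge0 ?ler0n.
- by apply/measurable_EFinP; apply: measurable_funM => //; exact: measurable_near_diag.
- exact: measurable_int (integrable_eta_box h N x).
- move=> y _; rewrite -EFinM lee_fin near_diagE.
  case: (leP `|x - y| (h / 2)) => Hxy; last by rewrite mulr0 mulr_ge0 ?eta_ge0 ?box_ge0.
  rewrite mulr1 boxE (_ : `|y| <= N); last first.
    have := ler_normB x (x - y); rewrite opprB addrC subrK; lra.
  rewrite mulr1; apply: eta_ge; rewrite normrM normfV (gtr0_norm h0) ler_pdivrMr//; lra.
Qed.

Lemma norm_deta_rescale_le h z : 0 < h -> `|deta (z / h) / h| <= 4 / h.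
Proof.
by move=> h0; rewrite normrM normfV (gtr0_norm h0) ler_pM2r ?invr_gt0// norm_deta_le.
Qed.

Lemma integrable_deta_box h N x : 0 < h ->
  mu.-integrable setT (EFin \o (fun y => deta ((x - y) / h) / h * box N y)).
Proof.
move=> h0; apply: (@integrable_box_mul _ (4 / h)).
  by apply: measurable_funM => //; apply: measurable_rescale => //; exact: measurable_deta.
by move=> y; exact: norm_deta_rescale_le.
Qed.

(** In y the integrand has primitive -eta((x - y) / h). Only endpoint values survive, and they
    vanish unless x is within h of N or -N. *)
Lemma integral_deta_box h N x : 0 < h -> 0 < N ->
  \int[mu]_y (deta ((x - y) / h) / h * box N y) =
  eta ((x + N) / h) - eta ((x - N) / h).
Proof.
move=> h0 N0.
have dF y : is_derive y 1 (fun y => - eta ((x - y) / h)) (deta ((x - y) / h) / h).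
  have H : is_derive y 1 (fun y : R => (x - y) / h) (- h^-1).
    by apply: is_derive_eq; rewrite /GRing.scale/= mulr0 add0r; ring.
  have H' := is_deriveN (@is_derive1_comp _ _ (fun y : R => (x - y) / h) y _ _ (is_derive_eta _) H).
  by apply: (@is_derive_eq _ _ _ _ _ _ _ _ H'); ring.
have cF : continuous (fun y => - eta ((x - y) / h)).
  by move=> y; have [/derivable1_diffP/differentiable_continuous] := dF y.
have cf : continuous (fun y => deta ((x - y) / h) / h).
  move=> y; apply: cvgM; last exact: cvg_cst.
  apply: (@continuous_comp _ _ _ (fun y => (x - y) / h) deta); last exact: continuous_deta.
  by apply: cvgM; [apply: cvgB; [exact: cvg_cst|exact: cvg_id]|exact: cvg_cst].
have H : (\int[mu]_(y in `[(- N)%R, N%R]) (deta ((x - y) / h) / h)%:E =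
          (- eta ((x - N) / h))%:E - (- eta ((x - - N) / h))%:E)%E.
  apply: (@continuous_FTC2 _ _ (fun y => - eta ((x - y) / h))).
  - lra.
  - exact: continuous_subspaceT.
  - split.
    + by move=> y _; have [] := dF y.
    + exact/cvg_at_right_filter/cF.
    + exact/cvg_at_left_filter/cF.
  - by move=> y _; rewrite derive1E; have [_ ->] := dF y.
rewrite integral_mkcond in H; rewrite /Rintegral.
have -> : (\int[mu]_y (deta ((x - y) / h) / h * box N y)%:E =
    (- eta ((x - N) / h))%:E - (- eta ((x - - N) / h))%:E)%E.
  rewrite -H; apply: eq_integral => y _.
  by rewrite patchE boxE mem_setE in_itv/= ler_norml; case: ifP; rewrite ?mulr1 ?mulr0.
by rewrite -EFinB/= !opprK addrC.
Qed.

End averages.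

(** * The entropy integrand averaged over the constants w(y) *)

Section averaged_inequality.
Context {R : realType}.
Notation mu := (@lebesgue_measure R).
Implicit Types (w : R -> R) (h N x y : R).

Lemma integrable_osc w M h N x : measurable_fun setT w -> (forall y, `|w y| <= M) ->
  mu.-integrable setT (EFin \o (fun y => `|w x - w y| * near_diag h x y * box N y)).
Proof.
move=> mw wM; apply: (@integrable_box_mul _ _ (M + M)).
  apply: measurable_funM; last exact: measurable_near_diag.
  by apply: measurableT_comp => //; exact: measurable_funB.
move=> y; rewrite normrM normr_id near_diagE.
rewrite (le_trans (ler_piMr _ _))//.
  by case: (_ <= h); rewrite ?normr1 ?normr0.
by rewrite (le_trans (ler_normB _ _))// lerD.
Qed.

Lemma EFin_osc w M h N x : measurable_fun setT w -> (forall y, `|w y| <= M) ->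
  (osc w h N x)%:E = (\int[mu]_y (`|w x - w y| * near_diag h x y * box N y)%:E)%E.
Proof.
move=> mw wM; rewrite /osc /Rintegral fineK// integrable_fin_num//.
exact: integrable_osc mw wM.
Qed.

Lemma osc_ge0 w h N x : 0 <= osc w h N x.
Proof.
by apply: Rintegral_ge0 => y _; rewrite mulr_ge0 ?box_ge0// mulr_ge0// near_diagE ler0n.
Qed.

(* The integrand of the entropy inequality for the constant [w y] and a test
   function [chi t * eta ((x - y) / h)], where [ch] is the value of chi and
   [dch] that of its derivative. *)
Definition kruzhkov (f w : R -> R) (dch ch v h x y : R) : R :=
  `|v - w y| * (dch * eta ((x - y) / h)) +
  eflux f v (w y) * (ch * (deta ((x - y) / h) / h)).

Lemma norm_kruzhkov (f w : R -> R) (M L dch ch v h x y : R) :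
  (forall x y, `|x| <= M -> `|y| <= M -> `|f x - f y| <= L * `|x - y|) ->
  0 <= L -> (forall y, `|w y| <= M) -> `|v| <= M -> 0 < h ->
  `|kruzhkov f w dch ch v h x y| <=
    (M + M) * `|dch| + L * (M + M) * (`|ch| * (4 / h)).
Proof.
move=> fL L0 wM vM h0; rewrite (le_trans (ler_normD _ _))//.
rewrite (normrM `|_|) (normrM (eflux _ _ _)) normr_id (normrM dch) (normrM ch).
have vw : `|v - w y| <= M + M by rewrite (le_trans (ler_normB _ _))// lerD.
apply: lerD; apply: ler_pM => //; rewrite ?mulr_ge0//.
- by rewrite ler_piMr// ger0_norm ?eta_ge0// eta_le1.
- by rewrite (le_trans (norm_eflux fL vM (wM y)))// ler_wpM2l.
- by rewrite ler_wpM2l// norm_deta_rescale_le.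
Qed.

(** Integrates [kruzhkov_integrand_le] in y: its three terms produce [mass], [osc] and the boundary
    values of [eta]. *)
Lemma averaged_le (f w : R -> R) (M L N h th1 th2 ch v b x : R) :
  measurable_fun setT f ->
  (forall x y, `|x| <= M -> `|y| <= M -> `|f x - f y| <= L * `|x - y|) ->
  0 <= L -> measurable_fun setT w -> (forall y, `|w y| <= M) -> `|v| <= M ->
  0 < N -> 0 < h -> 0 <= th1 -> 0 <= th2 -> 0 <= ch ->
  (\int[mu]_y (kruzhkov f w (th1 - th2) ch v h x y * box N y)%:E <=
   ((th1 * `|v - w x| + th2 * (`|v - b| - `|b - w x|)) * mass h N x +
    (th1 + th2 + ch * (L * (4 / h))) * osc w h N x +
    ch * eflux f v (w x) * (eta ((x + N) / h) - eta ((x - N) / h)))%:E)%E.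
Proof.
move=> mf fL L0 mw wM vM N0 h0 th10 th20 ch0.
set c1 := _ + th2 * _; set c2 := _ + ch * _; set c3 := ch * _.
have iK : mu.-integrable setT (EFin \o (fun y => kruzhkov f w (th1 - th2) ch v h x y * box N y)).
  apply: integrable_box_mul; last by move=> y; exact: norm_kruzhkov fL L0 wM vM h0.
  apply: measurable_funD; apply: measurable_funM.
  - by apply: measurableT_comp => //; exact: measurable_funB.
  - apply: measurable_funM => //; apply: measurable_rescale => //; exact: measurable_eta.
  - exact: measurable_eflux.
  - apply: measurable_funM => //; apply: measurable_funM => //.
    by apply: measurable_rescale => //; exact: measurable_deta.
have i1 := integrable_eta_box h N x.
have i2 := integrable_osc h N x mw wM.
have i3 := integrable_deta_box N x h0.
have iZ (c : R) (g : R -> R) : mu.-integrable setT (EFin \o g) ->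
    mu.-integrable setT (EFin \o (fun y => c * g y)).
  by move=> ig; have := integrableZl measurableT c ig.
have i12 : mu.-integrable setT (EFin \o (fun y => c1 * (eta ((x - y) / h) * box N y) +
   c2 * (`|w x - w y| * near_diag h x y * box N y))).
  by have := integrableD measurableT (iZ c1 _ i1) (iZ c2 _ i2).
rewrite -[leLHS]fineK; last exact: integrable_fin_num.
rewrite lee_fin /osc /mass -(integral_deta_box x h0 N0).
rewrite -!RintegralZl// -!RintegralD//; [|exact: iZ..].
apply: le_Rintegral => //.
  by have := integrableD measurableT i12 (iZ c3 _ i3).
move=> y _; rewrite (mulrA c1) (mulrA c2 (_ * _)) (mulrA c3) -!mulrDl ler_wpM2r ?box_ge0//.
(* Off the strip |x - y| <= h the kernel and its derivative vanish, which is why [osc] may carry the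
   factor [near_diag]. *)
have [xyh|/ltW xyh] := leP `|x - y| h; last first.
  rewrite /kruzhkov near_diagE eta_rescale_eq0// deta_rescale_eq0//.
  rewrite !(mul0r, mulr0) addr0 add0r addr0 mulr_ge0//.
    by rewrite addr_ge0 ?addr_ge0// mulr_ge0// mulr_ge0// divr_ge0// ltW.
rewrite near_diagE xyh mulr1.
apply: (@kruzhkov_integrand_le _ f M L _ _ _ _ (eta ((x - y) / h)) (deta ((x - y) / h) / h)
  _ _ _ b fL vM (wM x) (wM y) th10 th20 ch0); first by rewrite eta_ge0 eta_le1.
exact: norm_deta_rescale_le.
Qed.

End averaged_inequality.

Lemma le_integral_fubini_compensated d1 d2 (T1 : measurableType d1)
    (T2 : measurableType d2) (R : realType)
    (m1 : {sigma_finite_measure set T1 -> \bar R})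
    (m2 : {sigma_finite_measure set T2 -> \bar R})
    (G : T1 * T2 -> \bar R) (H1 H2 : T1 -> \bar R) :
  (m1 \x m2)%E.-integrable setT G ->
  (forall y, (0 <= \int[m1]_x G (x, y))%E) ->
  measurable_fun setT H1 -> measurable_fun setT H2 ->
  (forall x, (0 <= H1 x)%E) -> (forall x, (0 <= H2 x)%E) ->
  {ae m1, forall x, (H2 x + \int[m2]_y G (x, y) <= H1 x)%E} ->
  (\int[m1]_x H2 x <= \int[m1]_x H1 x)%E.
Proof.
move=> iG G0; apply: le_integral_ge0_compensated; first exact: (integrable_fubini_F iG).
exact: fubini_integral_ge0.
Qed.

(** * Lebesgue measure on the plane as a sigma-finite measure *)

Section plane_measure.
Context {R : realType}.
Notation mu := (@lebesgue_measure R).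

(* The library's sigma-finite structure on [m1 \x m2] is never inferred: it is
   shadowed by the instance for subprobabilities. *)
Definition plane_measure := (mu \x mu)%E.

HB.instance Definition _ := Measure.on plane_measure.

Let plane_measure_sigma_finite : sigma_finite setT plane_measure.
Proof.
exists (fun n => `[- n%:R, n%:R]%classic `*` `[- n%:R, n%:R]%classic).
  apply/esym; rewrite -subTset => -[x y] _.
  have bound (z : R) (n : nat) : `|z| <= n%:R -> `[- n%:R, n%:R]%classic z.
    by rewrite /= in_itv/= ler_norml.
  have /ltW xyn := truncnS_gt (Num.max `|x| `|y|).
  exists (Num.truncn (Num.max `|x| `|y|)).+1 => //.
  by split; apply: bound; rewrite (le_trans _ xyn)// le_max lexx ?orbT.
move=> n; split; first exact: measurableX.
rewrite /plane_measure product_measure1E//.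
have itv_fin (a b : R) : mu `[a, b]%classic \is a fin_num.
  by rewrite ge0_fin_numE//= lebesgue_measure_itv; case: ifP => // _; rewrite -EFinB ltry.
by rewrite -ge0_fin_numE ?mule_ge0// fin_numM// itv_fin.
Qed.

HB.instance Definition _ := Measure_isSigmaFinite.Build _ _ _ plane_measure
  plane_measure_sigma_finite.

Lemma le_integral_fubini_plane (G : (R * R) * R -> \bar R) (H1 H2 : R * R -> \bar R) :
  ((mu \x mu) \x mu)%E.-integrable setT G ->
  (forall y, (0 <= \int[(mu \x mu)]_p G (p, y))%E) ->
  measurable_fun setT H1 -> measurable_fun setT H2 ->
  (forall p, (0 <= H1 p)%E) -> (forall p, (0 <= H2 p)%E) ->
  {ae (mu \x mu)%E, forall p, (H2 p + \int[mu]_y G (p, y) <= H1 p)%E} ->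
  (\int[(mu \x mu)]_p H2 p <= \int[(mu \x mu)]_p H1 p)%E.
Proof.
exact: (@le_integral_fubini_compensated _ _ _ _ R plane_measure mu G H1 H2).
Qed.

End plane_measure.

(** * Integration in time and space *)

Section averaged_entropy_inequality.
Context {R : realType}.
Notation mu := (@lebesgue_measure R).
Implicit Types (w : R -> R) (h N x y d T a : R).

(** A nonnegative bump on [a, a + d] approximating the Dirac mass at a; chi' is the ramp at d minus
    the ramp at T. *)
Definition ramp a d t : R := - (detap ((t - a) / d) / d).

Lemma dplateauE T d t : dplateau T d t = ramp d d t - ramp T d t.
Proof. by rewrite /dplateau /ramp opprK addrC. Qed.

Lemma measurable_ramp a d : measurable_fun setT (ramp a d).
Proof.
apply: continuous_measurable_fun => t; apply: cvgN; apply: cvgM; last exact: cvg_cst.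
by apply: continuous_rescale; exact: continuous_detap.
Qed.

Lemma ramp_ge0 a d t : 0 < d -> 0 <= ramp a d t.
Proof. by move=> d0; rewrite oppr_ge0 mulr_le0_ge0 ?detap_le0// invr_ge0 ltW. Qed.

Lemma ramp_le a d t : 0 < d -> ramp a d t <= 4 / d * \1_(`[a, a + d]%classic) t.
Proof.
move=> d0; rewrite /ramp indicE mem_setE in_itv/= -mulNr.
have [/andP[ta tad]|H] := boolP (_ && _).
  by rewrite mulr1 ler_pM2r ?invr_gt0// (le_trans _ (norm_detap_le ((t - a) / d)))// -normrN ler_norm.
rewrite detap_eq0 ?oppr0 ?mul0r ?mulr0//.
move: H; rewrite negb_and -!ltNge => /orP[H|H]; [left|right].
  by rewrite pmulr_lle0 ?invr_gt0//; lra.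
by rewrite ler_pdivlMr//; lra.
Qed.

Lemma ramp_ge a d t : 0 < d ->
  1 / 4 / d * \1_(`[a + d / 4, a + 3 * d / 4]%classic) t <= ramp a d t.
Proof.
move=> d0; rewrite indicE mem_setE in_itv/=.
have [/andP[ta tad]|H] := boolP (_ && _); last by rewrite mulr0 ramp_ge0.
rewrite mulr1 /ramp -mulNr ler_pM2r ?invr_gt0// lerNr; apply: detap_le.
by rewrite ler_pdivlMr// ler_pdivrMr//; apply/andP; split; lra.
Qed.

Lemma measurable_Rintegral_section (g : R * R -> R) : measurable_fun setT g ->
  (forall p, 0 <= g p) -> measurable_fun setT (fun x => \int[mu]_y g (x, y)).
Proof.
move=> mg g0.
have H := @measurable_fun_fubini_tonelli_F _ _ _ _ R mu (EFin \o g).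
apply: (measurableT_comp (f := fine) _ (H _ _)) => //.
exact/measurable_EFinP.
Qed.

Lemma measurable_mass h N : measurable_fun setT (mass h N).
Proof.
apply: (@measurable_Rintegral_section (fun p => eta ((p.1 - p.2) / h) * box N p.2)).
  apply: measurable_funM; first by apply: measurable_rescale => //; exact: measurable_eta.
  by apply: measurableT_comp => //; exact: measurable_box.
by move=> p; rewrite mulr_ge0 ?eta_ge0 ?box_ge0.
Qed.

Lemma measurable_osc w h N : measurable_fun setT w -> measurable_fun setT (osc w h N).
Proof.
move=> mw.
apply: (@measurable_Rintegral_section
  (fun p => `|w p.1 - w p.2| * near_diag h p.1 p.2 * box N p.2)).
  apply: measurable_funM; last by apply: measurableT_comp => //; exact: measurable_box.
  apply: measurable_funM; last exact: measurable_near_diag.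
  by apply: measurableT_comp => //; apply: measurable_funB; apply: measurableT_comp.
by move=> p; rewrite mulr_ge0 ?box_ge0// mulr_ge0// near_diagE ler0n.
Qed.

Lemma measurable_kruzhkov e (X : measurableType e) (f w : R -> R) h (dch ch v x y : X -> R) :
  measurable_fun setT f -> measurable_fun setT w ->
  measurable_fun setT dch -> measurable_fun setT ch -> measurable_fun setT v ->
  measurable_fun setT x -> measurable_fun setT y ->
  measurable_fun setT (fun z => kruzhkov f w (dch z) (ch z) (v z) h (x z) (y z)).
Proof.
move=> mf mw mdch mch mv mx my.
apply: measurable_funD; apply: measurable_funM.
- apply: measurableT_comp => //; apply: measurable_funB => //; exact: measurableT_comp.
- apply: measurable_funM => //; apply: measurable_rescale => //; exact: measurable_eta.
- by apply: measurable_eflux => //; exact: measurableT_comp.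
- apply: measurable_funM => //; apply: measurable_funM => //.
  by apply: measurable_rescale => //; exact: measurable_deta.
Qed.

(* Here [wT] is the solution at time [T]; its distance to [w], weighted by
   [ramp T d], is what is left on the other side of [integral_upper_ge]. *)
Definition upper (w wT : R -> R) (U : R * R -> R) (L M N T d h : R) (p : R * R) : R :=
  (ramp d d p.1 * `|U p - w p.2| + ramp T d p.1 * `|U p - wT p.2|) * mass h N p.2 +
  (ramp d d p.1 + ramp T d p.1 + plateau T d p.1 * (L * (4 / h))) * osc w h N p.2 +
  plateau T d p.1 * (L * (M + M)) * (eta ((p.2 + N) / h) + eta ((p.2 - N) / h)).

Lemma measurable_upper (w wT : R -> R) (U : R * R -> R) (L M N T d h : R) :
  measurable_fun setT w -> measurable_fun setT wT -> measurable_fun setT U ->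
  measurable_fun setT (upper w wT U L M N T d h).
Proof.
move=> mw mwT mU.
have m1 (g : R -> R) : measurable_fun setT g -> measurable_fun setT (fun p : R * R => g p.1).
  by move=> mg; exact: (measurableT_comp mg).
have m2 (g : R -> R) : measurable_fun setT g -> measurable_fun setT (fun p : R * R => g p.2).
  by move=> mg; exact: (measurableT_comp mg).
have mr1 := m1 _ (measurable_ramp d d).
have mr2 := m1 _ (measurable_ramp T d).
have mp := m1 _ (measurable_plateau T d).
have mm := m2 _ (measurable_mass h N).
have mo := m2 _ (measurable_osc h N mw).
have me a : measurable_fun setT (fun p : R * R => eta ((p.2 - a) / h)).
  by apply: measurable_rescale => //; exact: measurable_eta.
apply: measurable_funD; first apply: measurable_funD.
- apply: measurable_funM => //; apply: measurable_funD; apply: measurable_funM => //;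
    by apply: measurableT_comp => //; apply: measurable_funB => //; exact: m2.
- apply: measurable_funM => //; apply: measurable_funD; first exact: measurable_funD.
  exact: measurable_funM.
- apply: measurable_funM; first exact: measurable_funM.
  apply: measurable_funD => //; have := me (- N).
  by under eq_fun do rewrite opprK.
Qed.

Lemma upper_ge0 (w wT : R -> R) (U : R * R -> R) (L M N T d h : R) (p : R * R) :
  0 <= L -> 0 <= M -> 0 < h -> 0 < d -> d <= T -> 0 <= upper w wT U L M N T d h p.
Proof.
move=> L0 M0 h0 d0 dT; have /andP[ch0 _] := plateau_itv p.1 d0 dT.
have h4 : 0 <= 4 / h by rewrite divr_ge0// ltW.
rewrite !addr_ge0//.
- by rewrite mulr_ge0 ?mass_ge0// addr_ge0// mulr_ge0// ramp_ge0.
- apply: mulr_ge0; last exact: osc_ge0.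
  apply: addr_ge0; first by apply: addr_ge0; exact: ramp_ge0.
  by apply: mulr_ge0 => //; exact: mulr_ge0.
- apply: mulr_ge0; last by apply: addr_ge0; exact: eta_ge0.
  by apply: mulr_ge0 => //; apply: mulr_ge0 => //; exact: addr_ge0.
Qed.

(** [V] and [U] are two representatives of the solution: [V] is bounded everywhere, which gives
    integrability; [U] is the one whose continuity in time is used later. *)
Lemma integral_upper_ge (f w wT : R -> R) (U V : R * R -> R) (L M N T d h : R) :
  measurable_fun setT f ->
  (forall x y, `|x| <= M -> `|y| <= M -> `|f x - f y| <= L * `|x - y|) ->
  0 <= L -> measurable_fun setT w -> (forall y, `|w y| <= M) ->
  measurable_fun setT wT ->
  measurable_fun setT V -> (forall p, `|V p| <= M) ->
  measurable_fun setT U -> {ae (mu \x mu)%E, forall p, V p = U p} ->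
  0 < N -> 0 < h -> 0 < d -> d <= T ->
  (forall y, (0 <= \int[(mu \x mu)]_p
    (kruzhkov f w (dplateau T d p.1) (plateau T d p.1) (V p) h p.2 y)%:E)%E) ->
  (\int[(mu \x mu)]_p (ramp T d p.1 * (`|wT p.2 - w p.2| * mass h N p.2))%:E <=
   \int[(mu \x mu)]_p (upper w wT U L M N T d h p)%:E)%E.
Proof.
move=> mf fL L0 mw wM mwT mV VM mU VU N0 h0 d0 dT ent.
have M0 : 0 <= M by exact: le_trans (wM 0).
have ch01 t := plateau_itv t d0 dT.
have h4 : 0 <= 4 / h by rewrite divr_ge0// ltW.
have itv_fin (a b : R) : (mu `[a, b]%classic < +oo)%E.
  by rewrite /= lebesgue_measure_itv; case: ifP => // _; rewrite -EFinB ltry.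
have itv_fin_num (a b : R) : mu `[a, b]%classic \is a fin_num.
  by rewrite ge0_fin_numE// itv_fin.
(* Bounded support in (t, x, y): the plateau confines t, the box confines y, and the kernel then
   confines x. *)
have supp (t x y v : R) :
    kruzhkov f w (dplateau T d t) (plateau T d t) v h x y * box N y = 0 \/
    [/\ d <= t <= T + d, `|x| <= N + h & `|y| <= N].
  have [yN|yN] := leP `|y| N; last by left; rewrite boxE leNgt yN mulr0.
  have [xN|xN] := leP `|x| (N + h); last first.
    have xy : h <= `|x - y| by have := ler_normD (x - y) y; rewrite subrK; lra.
    left; rewrite /kruzhkov eta_rescale_eq0// deta_rescale_eq0//.
    by rewrite !(mul0r, mulr0) addr0 mul0r.
  have [td|td] := leP t d.
    left; rewrite /kruzhkov plateau_eq0 ?dplateau_eq0//; [|by left..].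
    by rewrite !(mul0r, mulr0) addr0 mul0r.
  have [tT|tT] := leP (T + d) t.
    left; rewrite /kruzhkov plateau_eq0 ?dplateau_eq0//; [|by right..].
    by rewrite !(mul0r, mulr0) addr0 mul0r.
  by right; split=> //; rewrite !ltW.
pose G := fun q : (R * R) * R =>
  kruzhkov f w (dplateau T d q.1.1) (plateau T d q.1.1) (V q.1) h q.1.2 q.2 * box N q.2.
have iG : ((mu \x mu) \x mu)%E.-integrable setT (EFin \o G).
  apply: (@integrable_bounded_support _ _ _ ((mu \x mu) \x mu)%E
    ((`[d, T + d]%classic `*` `[- (N + h), N + h]%classic) `*` `[- N, N]%classic)
    (* 8 / d bounds |chi'|: two ramps, each at most 4 / d. *)
    ((M + M) * (8 / d) + L * (M + M) * (1 * (4 / h)))).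
  - by apply: measurableX => //; exact: measurableX.
  - rewrite /= product_measure1E//; last exact: measurableX.
    rewrite /= product_measure1E//; apply: lte_mul_pinfty.
    + by apply: mule_ge0; exact: measure_ge0.
    + by apply: fin_numM; exact: itv_fin_num.
    + exact: itv_fin.
  - apply: measurable_funM; last by apply: measurableT_comp => //; exact: measurable_box.
    apply: measurable_kruzhkov => //.
    + apply: (measurableT_comp (measurable_dplateau T d)); exact: measurableT_comp.
    + apply: (measurableT_comp (measurable_plateau T d)); exact: measurableT_comp.
    + exact: measurableT_comp.
    + exact: measurableT_comp.
  - move=> [[t x] y]; rewrite /G/= normrM.
    rewrite (le_trans (ler_piMr _ _))//.
      by rewrite boxE; case: (_ <= N); rewrite ?normr1 ?normr0.
    rewrite (le_trans (norm_kruzhkov _ _ _ _ fL L0 wM (VM _) h0))//.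
    apply: lerD; apply: ler_wpM2l; rewrite ?addr_ge0 ?mulr_ge0 ?addr_ge0//.
      rewrite /dplateau (le_trans (ler_normB _ _))//.
      rewrite (normrM (detap ((t - T) / d))) (normrM (detap ((t - d) / d))).
      rewrite normfV (gtr0_norm d0).
      rewrite -mulrDl ler_pM2r ?invr_gt0// (_ : 8 = 4 + 4); last by ring.
      by rewrite lerD// norm_detap_le.
    rewrite ler_wpM2r//; have /andP[ch0 ch1] := ch01 t.
    by rewrite ger0_norm.
  - move=> [[t x] y] H; have [//|[td xN yN]] := supp t x y (V (t, x)).
    by exfalso; apply: H; rewrite /= !in_itv/= -!ler_norml.
apply: (le_integral_fubini_plane iG).
- move=> y; rewrite /= /G/= boxE; case: (_ <= N).
    by under eq_integral do rewrite mulr1; exact: ent.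
  by rewrite integral0_eq// => p _; rewrite mulr0.
- by apply/measurable_EFinP; exact: measurable_upper.
- apply/measurable_EFinP/measurable_funM.
    by apply: (measurableT_comp (measurable_ramp T d)).
  apply: measurable_funM; last by apply: (measurableT_comp (measurable_mass h N)).
  by apply: measurableT_comp => //; apply: measurable_funB; exact: measurableT_comp.
- by move=> p; rewrite lee_fin upper_ge0.
- by move=> p; rewrite lee_fin mulr_ge0 ?ramp_ge0// mulr_ge0// mass_ge0.
(* [averaged_le] with b = u(T,x); the negative term is moved to the left, and the boundary term is
   bounded through |q| <= L (M + M), which turns the difference of the two [eta] into a sum. *)
- case: VU => A [mA A0 AVU]; exists A; split => // -[t x] ntx.
  apply: AVU => VUp; apply: ntx; rewrite /G/= dplateauE.
  have /andP[ch0 ch1] := ch01 t.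
  have := averaged_le (wT x) x mf fL L0 mw wM (VM (t, x)) N0 h0
    (ramp_ge0 d t d0) (ramp_ge0 T t d0) ch0.
  move=> /(leeD2l (ramp T d t * (`|wT x - w x| * mass h N x))%:E)/le_trans; apply.
  rewrite -EFinD lee_fin /upper/= -VUp.
  have q : `|eflux f (V (t, x)) (w x)| <= L * (M + M).
    rewrite (le_trans (norm_eflux fL (VM _) (wM x)))// ler_wpM2l//.
    by rewrite (le_trans (ler_normB _ _))// lerD.
  have E (a b e : R) : `|a| <= b -> 0 <= e -> a * e <= b * e.
    by move=> ab e0; rewrite ler_wpM2r// (le_trans (ler_norm _)).
  have q1 := E _ _ _ q (eta_ge0 ((x + N) / h)).
  rewrite -normrN in q; have q2 := E _ _ _ q (eta_ge0 ((x - N) / h)).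
  have := ler_wpM2l ch0 (lerD q1 q2).
  lra.
Qed.

End averaged_entropy_inequality.

(** * Bounds for the individual integrals *)

Section local_estimate.
Context {R : realType}.
Notation mu := (@lebesgue_measure R).
Implicit Types (h N y d T a b c e : R).

(** Peels one term off a sum. The bound on [g] is asked only for a > 0 because [a] will be a ramp at
    time t, and u(t) is controlled only on the support of the ramp. *)
Lemma integral_affine_le dd (X : measurableType dd) (m : {measure set X -> \bar R})
    (g k : X -> R) a b c : 0 <= a ->
  measurable_fun setT g -> (forall x, 0 <= g x) ->
  measurable_fun setT k -> (forall x, 0 <= k x) ->
  (0 < a -> (\int[m]_x (g x)%:E <= b%:E)%E) ->
  (\int[m]_x (k x)%:E <= c%:E)%E ->
  (\int[m]_x (a * g x + k x)%:E <= (a * b + c)%:E)%E.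
Proof.
move=> a0 mg g0 mk k0 gb kc; under eq_integral do rewrite EFinD EFinM.
rewrite ge0_integralD//; last 4 first.
- by move=> x _; rewrite -EFinM lee_fin mulr_ge0.
- by apply/measurable_EFinP; exact: measurable_funM.
- by move=> x _; rewrite lee_fin.
- exact/measurable_EFinP.
rewrite ge0_integralZl_EFin//; last 2 first.
- by move=> x _; rewrite lee_fin.
- exact/measurable_EFinP.
rewrite EFinD EFinM leeD//.
move: a0; rewrite le_eqVlt => /predU1P[<-|a0]; first by rewrite !mul0e.
by rewrite lee_pmul2l// gb.
Qed.

Lemma integral_indic_itv a b : a <= b ->
  (\int[mu]_x (\1_(`[a, b]%classic) x)%:E = (b - a)%:E)%E.
Proof.
move=> ab; rewrite integral_indic// setIT /= lebesgue_measure_itv/= lte_fin.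
by case: ltP => [_|ba]; rewrite -?EFinB// (@le_anti _ _ a b) ?ab ?subrr.
Qed.

(** The exact value is 1; a height of 4 / d on a length d is enough. *)
Lemma integral_ramp_le a d : 0 < d -> (\int[mu]_t (ramp a d t)%:E <= 4%:E)%E.
Proof.
move=> d0.
have -> : (4 : R) = 4 / d * (a + d - a) by field; rewrite gt_eqF.
rewrite EFinM -integral_indic_itv; last by rewrite lerDl ltW.
rewrite -ge0_integralZl_EFin//; last 2 first.
- by apply/measurable_EFinP; exact: measurable_indic.
- by rewrite divr_ge0// ltW.
apply: ge0_le_integral => //.
- by move=> t _; rewrite lee_fin ramp_ge0.
- by apply/measurable_EFinP; exact: measurable_ramp.
- by apply/measurable_EFinP; apply: measurable_funM => //; exact: measurable_indic.
- by move=> t _; rewrite -EFinM lee_fin ramp_le.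
Qed.

Lemma integral_ramp_ge a d : 0 < d -> ((1 / 8)%:E <= \int[mu]_t (ramp a d t)%:E)%E.
Proof.
move=> d0.
have -> : (1 / 8 : R) = 1 / 4 / d * (a + 3 * d / 4 - (a + d / 4)) by field; rewrite gt_eqF.
rewrite EFinM -integral_indic_itv; last lra.
rewrite -ge0_integralZl_EFin//; last 2 first.
- by apply/measurable_EFinP; exact: measurable_indic.
- by rewrite divr_ge0// ltW.
apply: ge0_le_integral => //.
- by move=> t _; rewrite -EFinM lee_fin mulr_ge0// divr_ge0// ltW.
- by apply/measurable_EFinP; apply: measurable_funM => //; exact: measurable_indic.
- by apply/measurable_EFinP; exact: measurable_ramp.
- by move=> t _; rewrite -EFinM lee_fin ramp_ge.
Qed.

Lemma integral_plateau_le T d : 0 < d -> d <= T ->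
  (\int[mu]_t (plateau T d t)%:E <= T%:E)%E.
Proof.
move=> d0 dT.
have {2}-> : T = T + d - d by ring.
rewrite -integral_indic_itv; last lra.
apply: ge0_le_integral => //.
- by move=> t _; rewrite lee_fin; have /andP[] := plateau_itv t d0 dT.
- by apply/measurable_EFinP; exact: measurable_plateau.
- by apply/measurable_EFinP; exact: measurable_indic.
- move=> t _; rewrite lee_fin indicE mem_setE in_itv/=.
  have [_|H] := boolP (_ && _); first by have /andP[] := plateau_itv t d0 dT.
  rewrite plateau_eq0//; move: H; rewrite negb_and -!ltNge => /orP[/ltW|/ltW]; [by left|by right].
Qed.

Lemma near_diagC h x y : near_diag h x y = near_diag h y x.
Proof. by rewrite !near_diagE distrC. Qed.

Lemma integral_eta_le h y : 0 < h -> (\int[mu]_x (eta ((x - y) / h))%:E <= (2 * h)%:E)%E.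
Proof.
move=> h0; rewrite -(@integral_near_diag _ h y); last exact: ltW.
apply: ge0_le_integral => //.
- by move=> x _; rewrite lee_fin eta_ge0.
- by apply/measurable_EFinP; apply: measurable_rescale => //; exact: measurable_eta.
- by apply/measurable_EFinP; exact: measurable_near_diag.
- by move=> x _; rewrite lee_fin near_diagC eta_near_diag.
Qed.

Lemma integral_mass_le h N (g : R -> R) e : 0 < h -> measurable_fun setT g ->
  (forall x, 0 <= g x) ->
  (\int[mu]_(x in `[(- (N + h))%R, (N + h)%R]) (g x)%:E <= e%:E)%E ->
  (\int[mu]_x (g x * mass h N x)%:E <= (2 * h * e)%:E)%E.
Proof.
move=> h0 mg g0 ge; have h20 : 0 <= 2 * h by rewrite mulr_ge0// ltW.
apply: (@le_trans _ _ ((2 * h)%:E * \int[mu]_x (g x * box (N + h) x)%:E)%E); last first.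
  rewrite (EFinM (2 * h)) lee_wpmul2l ?lee_fin//; apply: le_trans ge.
  rewrite [leRHS]integral_mkcond; apply: ge0_le_integral => //.
  - by move=> x _; rewrite lee_fin mulr_ge0 ?box_ge0.
  - by apply/measurable_EFinP; apply: measurable_funM => //; exact: measurable_box.
  - by apply/(measurable_restrictT _ _).1 => //; apply: measurable_funTS; exact/measurable_EFinP.
  - move=> x _; rewrite patchE boxE mem_setE in_itv/= ler_norml.
    by case: ifP; rewrite ?mulr1 ?mulr0.
rewrite -ge0_integralZl_EFin//; last 2 first.
- by move=> x _; rewrite lee_fin mulr_ge0 ?box_ge0.
- by apply/measurable_EFinP; apply: measurable_funM => //; exact: measurable_box.
apply: ge0_le_integral => //.
- by move=> x _; rewrite lee_fin mulr_ge0 ?mass_ge0.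
- by apply/measurable_EFinP; apply: measurable_funM => //; exact: measurable_mass.
- apply/measurable_EFinP; apply: measurable_funM => //.
  by apply: measurable_funM => //; exact: measurable_box.
- by move=> x _; rewrite -EFinM lee_fin mulrCA ler_wpM2l// mass_le.
Qed.

Lemma integral_mass_ge h N (g : R -> R) : 0 < h -> measurable_fun setT g ->
  (forall x, 0 <= g x) ->
  ((h / 2)%:E * \int[mu]_(x in `[(- (N - h))%R, (N - h)%R]) (g x)%:E <=
   \int[mu]_x (g x * mass h N x)%:E)%E.
Proof.
move=> h0 mg g0; have h20 : 0 <= h / 2 by rewrite divr_ge0// ltW.
rewrite integral_mkcond -ge0_integralZl_EFin//; last 2 first.
- by move=> x _; rewrite patchE; case: ifP => // _; rewrite lee_fin.
- by apply/(measurable_restrictT _ _).1 => //; apply: measurable_funTS; exact/measurable_EFinP.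
apply: ge0_le_integral => //.
- move=> x _; rewrite mule_ge0 ?lee_fin// patchE; case: ifP => // _; by rewrite lee_fin.
- apply: measurable_funeM.
  by apply/(measurable_restrictT _ _).1 => //; apply: measurable_funTS; exact/measurable_EFinP.
- by apply/measurable_EFinP; apply: measurable_funM => //; exact: measurable_mass.
- move=> x _; rewrite patchE mem_setE in_itv/= -ler_norml; case: ifPn => H.
    by rewrite -EFinM lee_fin mulrC ler_wpM2l// mass_ge.
  by rewrite mule0 lee_fin mulr_ge0 ?mass_ge0.
Qed.

End local_estimate.

(** * The L^1 estimate on a bounded interval *)

Section local_L1_estimate.
Context {R : realType}.
Notation mu := (@lebesgue_measure R).

Lemma tonelli_plane (g : R * R -> R) : measurable_fun setT g -> (forall p, 0 <= g p) ->
  (\int[(mu \x mu)]_p (g p)%:E = \int[mu]_t \int[mu]_x (g (t, x))%:E)%E.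
Proof.
move=> mg g0; apply: (@fubini_tonelli1 _ _ _ _ R mu mu (EFin \o g)).
- exact/measurable_EFinP.
- by move=> p; rewrite lee_fin.
Qed.

Lemma measurable_integral_section (g : R * R -> R) : measurable_fun setT g ->
  (forall p, 0 <= g p) -> measurable_fun setT (fun t => \int[mu]_x (g (t, x))%:E)%E.
Proof.
move=> mg g0; apply: (@measurable_fun_fubini_tonelli_F _ _ _ _ R mu (EFin \o g)).
- exact/measurable_EFinP.
- by move=> p; rewrite lee_fin.
Qed.

(** Tonelli, first in x at fixed t, then in t, where each ramp contributes at most 4 and the plateau
    at most T. *)
Lemma integral_upper_le (w wT : R -> R) (U : R * R -> R) (L M N T d h e J : R) :
  0 <= L -> 0 <= M -> 0 < h -> 0 < d -> d <= T -> 0 <= e -> 0 <= J ->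
  measurable_fun setT w -> measurable_fun setT wT -> measurable_fun setT U ->
  (forall t, d <= t <= d + d ->
    (\int[mu]_(x in `[(- (N + h))%R, (N + h)%R]) `|U (t, x) - w x|%:E <= e%:E)%E) ->
  (forall t, T <= t <= T + d ->
    (\int[mu]_(x in `[(- (N + h))%R, (N + h)%R]) `|U (t, x) - wT x|%:E <= e%:E)%E) ->
  (\int[mu]_x (osc w h N x)%:E <= J%:E)%E ->
  (\int[(mu \x mu)]_p (upper w wT U L M N T d h p)%:E <=
    (8 * (2 * h * e + J) + T * (L * (4 / h) * J + L * (M + M) * (4 * h)))%:E)%E.
Proof.
move=> L0 M0 h0 d0 dT e0 J0 mw mwT mU Ud UT oscJ.
have h4 : 0 <= 4 / h by rewrite divr_ge0// ltW.
(* The coefficients of the ramps and of the plateau after integration in x. The 4 * h in [K2] comes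
   from the two boundary bumps, each of integral at most 2 * h. *)
set K1 := 2 * h * e + J; set K2 := L * (4 / h) * J + _.
have K10 : 0 <= K1 by rewrite addr_ge0// !mulr_ge0// ltW.
have K20 : 0 <= K2.
  apply: addr_ge0; first by rewrite mulr_ge0// mulr_ge0.
  by apply: mulr_ge0; [rewrite mulr_ge0// addr_ge0|rewrite mulr_ge0// ltW].
have pl t : 0 <= plateau T d t by have /andP[] := plateau_itv t d0 dT.
have rdpos a t : 0 < ramp a d t -> a <= t <= a + d.
  move=> r0; have := lt_le_trans r0 (ramp_le a t d0).
  by rewrite indicE mem_setE in_itv/=; case: (_ && _); rewrite // mulr0 ltxx.
have rge a t := ramp_ge0 a t d0.
have i0 (m : {measure set (measurableTypeR R) -> \bar R}) : (\int[m]_x (0 : R)%:E <= (0 : R)%:E)%E.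
  by rewrite integral0.
rewrite tonelli_plane; last 2 first.
- exact: measurable_upper.
- by move=> p; exact: upper_ge0.
apply: (@le_trans _ _ (\int[mu]_t (K1 * ramp d d t + (K1 * ramp T d t + (K2 * plateau T d t + 0)))%:E)%E).
  have mr1 := measurable_ramp d d; have mr2 := measurable_ramp T d.
  have mp := measurable_plateau T d.
  apply: ge0_le_integral => //.
  - by move=> t _; apply: integral_ge0 => x _; rewrite lee_fin upper_ge0.
  - apply: measurable_integral_section; first exact: measurable_upper.
    by move=> p; exact: upper_ge0.
  - apply/measurable_EFinP.
    do 3 (apply: measurable_funD; first by apply: measurable_funM).
    exact: measurable_cst.
  move=> t _; rewrite /upper/=.
  have mUt : measurable_fun setT (fun x => U (t, x)).
    by apply: (measurableT_comp mU); exact: pair1_measurable.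
  have mabs (g : R -> R) : measurable_fun setT g -> measurable_fun setT (fun x => `|U (t, x) - g x|).
    by move=> mg; apply: measurableT_comp => //; exact: measurable_funB.
  have mm := @measurable_mass R h N.
  have me a : measurable_fun setT (fun x : R => eta ((x - a) / h)).
    by apply: measurable_rescale => //; exact: measurable_eta.
  have mo := measurable_osc h N mw.
  pose P := plateau T d t * (L * (M + M)).
  have P0 : 0 <= P by rewrite !mulr_ge0// addr_ge0.
  pose A := ramp d d t + ramp T d t + plateau T d t * (L * (4 / h)).
  have A0 : 0 <= A by apply: addr_ge0; [exact: addr_ge0|rewrite mulr_ge0// mulr_ge0].
  (* Nested to the right and ended by 0, so that [integral_affine_le] removes one term at a time. *)
  under eq_integral => x _.
    rewrite (_ : _ + _ =
      ramp d d t * (`|U (t, x) - w x| * mass h N x) +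
      (ramp T d t * (`|U (t, x) - wT x| * mass h N x) +
      (A * osc w h N x + (P * eta ((x - - N) / h) + (P * eta ((x - N) / h) + 0))))); last first.
      by rewrite /A /P opprK; ring.
    over.
  rewrite [leRHS](_ : _ = (ramp d d t * (2 * h * e) + (ramp T d t * (2 * h * e) +
     (A * J + (P * (2 * h) + (P * (2 * h) + 0)))))%:E); last first.
    by congr (_%:E); rewrite /A /P /K1 /K2; ring.
  have n1 (g : R -> R) x : 0 <= `|U (t, x) - g x| * mass h N x by rewrite mulr_ge0 ?mass_ge0.
  have m1 (g : R -> R) : measurable_fun setT g ->
      measurable_fun setT (fun x : R => `|U (t, x) - g x| * mass h N x).
    by move=> mg; apply: measurable_funM => //; exact: mabs.
  have n5 (x : R) : 0 <= P * eta ((x - N) / h) + 0 by rewrite addr0 mulr_ge0 ?eta_ge0.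
  have n4 (x : R) : 0 <= P * eta ((x - - N) / h) + (P * eta ((x - N) / h) + 0).
    by rewrite addr_ge0// mulr_ge0 ?eta_ge0.
  have n3 (x : R) : 0 <= A * osc w h N x + (P * eta ((x - - N) / h) + (P * eta ((x - N) / h) + 0)).
    by rewrite addr_ge0// mulr_ge0 ?osc_ge0.
  have m5 : measurable_fun setT (fun x : R => P * eta ((x - N) / h) + 0).
    by apply: measurable_funD => //; exact: measurable_funM.
  have m4 : measurable_fun setT (fun x : R => P * eta ((x - - N) / h) + (P * eta ((x - N) / h) + 0)).
    by apply: measurable_funD => //; exact: measurable_funM.
  have m3 : measurable_fun setT (fun x : R => A * osc w h N x + (P * eta ((x - - N) / h) + (P * eta ((x - N) / h) + 0))).
    by apply: measurable_funD => //; exact: measurable_funM.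
  apply: integral_affine_le => //; [exact: m1| | | |].
  - by apply: measurable_funD => //; apply: measurable_funM => //; exact: m1.
  - by move=> x; rewrite addr_ge0// mulr_ge0.
  - by move=> /rdpos tT; apply: integral_mass_le => //; [exact: mabs|exact: Ud].
  apply: integral_affine_le => //; [exact: m1| |].
  - by move=> /rdpos tT; apply: integral_mass_le => //; [exact: mabs|exact: UT].
  apply: integral_affine_le => //; first by move=> x; exact: osc_ge0.
  apply: integral_affine_le => //; [exact: me|by move=> x; exact: eta_ge0|by move=> _; exact: integral_eta_le|].
  apply: integral_affine_le => //; [exact: me|by move=> x; exact: eta_ge0|by move=> _; exact: integral_eta_le].
rewrite [leRHS](_ : _ = (K1 * 4 + (K1 * 4 + (K2 * T + 0)))%:E); last first.
  by congr (_%:E); ring.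
have mr1 := measurable_ramp d d; have mr2 := measurable_ramp T d.
have mp := measurable_plateau T d.
apply: integral_affine_le => //.
- do 2 (apply: measurable_funD; first by apply: measurable_funM).
  exact: measurable_cst.
- by move=> t; rewrite !addr_ge0// mulr_ge0.
- by move=> _; exact: integral_ramp_le.
apply: integral_affine_le => //.
- apply: measurable_funD; [exact: measurable_funM|exact: measurable_cst].
- by move=> t; rewrite !addr_ge0// mulr_ge0.
- by move=> _; exact: integral_ramp_le.
apply: integral_affine_le => // _; exact: integral_plateau_le.
Qed.

(** On the left of [integral_upper_ge] the ramp has mass at least 1/8 and [mass] is at least h / 2
    for |x| <= N - h; dividing by both gives the factor 16 / h. *)
Lemma local_L1_estimate (f w wT : R -> R) (U V : R * R -> R) (L M N T d h e J : R) :
  measurable_fun setT f ->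
  (forall x y, `|x| <= M -> `|y| <= M -> `|f x - f y| <= L * `|x - y|) ->
  0 <= L -> measurable_fun setT w -> (forall y, `|w y| <= M) ->
  measurable_fun setT wT ->
  measurable_fun setT V -> (forall p, `|V p| <= M) ->
  measurable_fun setT U -> {ae (mu \x mu)%E, forall p, V p = U p} ->
  0 < N -> 0 < h -> 0 < d -> d <= T -> 0 <= e -> 0 <= J ->
  (forall y, (0 <= \int[(mu \x mu)]_p
    (kruzhkov f w (dplateau T d p.1) (plateau T d p.1) (V p) h p.2 y)%:E)%E) ->
  (forall t, d <= t <= d + d ->
    (\int[mu]_(x in `[(- (N + h))%R, (N + h)%R]) `|U (t, x) - w x|%:E <= e%:E)%E) ->
  (forall t, T <= t <= T + d ->
    (\int[mu]_(x in `[(- (N + h))%R, (N + h)%R]) `|U (t, x) - wT x|%:E <= e%:E)%E) ->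
  (\int[mu]_x (osc w h N x)%:E <= J%:E)%E ->
  (\int[mu]_(x in `[(- (N - h))%R, (N - h)%R]) `|wT x - w x|%:E <=
    (16 / h * (8 * (2 * h * e + J) +
       T * (L * (4 / h) * J + L * (M + M) * (4 * h))))%:E)%E.
Proof.
move=> mf fL L0 mw wM mwT mV VM mU VU N0 h0 d0 dT e0 J0 ent Ud UT oscJ.
have M0 : 0 <= M by exact: le_trans (wM 0).
have Hlow := integral_upper_ge mf fL L0 mw wM mwT mV VM mU VU N0 h0 d0 dT ent.
have := le_trans Hlow (integral_upper_le L0 M0 h0 d0 dT e0 J0 mw mwT mU Ud UT oscJ).
set B := (X in (_ <= X%:E)%E).
have mg : measurable_fun setT (fun x => `|wT x - w x|).
  by apply: measurableT_comp => //; exact: measurable_funB.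
have mm := @measurable_mass R h N.
have mr := measurable_ramp T d.
have rge t := ramp_ge0 T t d0.
pose X := (\int[mu]_x (`|wT x - w x| * mass h N x)%:E)%E.
have X0 : (0 <= X)%E by apply: integral_ge0 => x _; rewrite lee_fin mulr_ge0 ?mass_ge0.
rewrite tonelli_plane; last 2 first.
- apply: measurable_funM; first exact: (measurableT_comp mr).
  by apply: (measurableT_comp (f := fun x => `|wT x - w x| * mass h N x)) => //; exact: measurable_funM.
- by move=> p; rewrite mulr_ge0// mulr_ge0 ?mass_ge0.
rewrite (_ : (\int[mu]_t \int[mu]_x _)%E = ((\int[mu]_t (ramp T d t)%:E) * X)%E); last first.
  rewrite -ge0_integralZr//; last 2 first.
  - exact/measurable_EFinP.
  - by move=> t _; rewrite lee_fin.
  apply: eq_integral => t _; rewrite /= -ge0_integralZl_EFin//.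
  - by move=> x _; rewrite lee_fin mulr_ge0 ?mass_ge0.
  - by apply/measurable_EFinP; exact: measurable_funM.
move=> XB.
have Hmass : ((h / 2)%:E * \int[mu]_(x in `[(- (N - h))%R, (N - h)%R]) `|wT x - w x|%:E <= X)%E.
  exact: integral_mass_ge.
have h160 : 0 < 16 / h by rewrite divr_gt0.
have : ((1 / 8)%:E * X <= B%:E)%E.
  by apply: le_trans XB; rewrite lee_wpmul2r// integral_ramp_ge.
move=> XB'.
have e8 : (0 <= (1 / 8 : R)%:E)%E by rewrite lee_fin.
have e16 : (0 <= (16 / h)%:E)%E by rewrite lee_fin ltW.
have := lee_wpmul2l e16 (le_trans (lee_wpmul2l e8 Hmass) XB').
rewrite !muleA -!EFinM.
by rewrite (_ : 16 / h * (1 / 8) * (h / 2) = 1) ?mul1e//; field; rewrite gt_eqF.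
Qed.

End local_L1_estimate.

(** * Representatives bounded everywhere *)

Section truncation.
Context {R : realType}.
Notation mu := (@lebesgue_measure R).
Implicit Types (M a b : R).

Definition clamp M a : R := Num.max (- M) (Num.min a M).

Lemma norm_clamp M a : 0 <= M -> `|clamp M a| <= M.
Proof.
move=> M0; have NM : - M <= M by lra.
by rewrite ler_norml /clamp le_max lexx ge_max NM ge_min lexx orbT.
Qed.

Lemma clamp_id M a : `|a| <= M -> clamp M a = a.
Proof.
by rewrite ler_norml => /andP[Ma aM]; rewrite /clamp (min_idPl aM) (max_idPr Ma).
Qed.

(** Ensures that clamping the datum does not increase its oscillation. *)
Lemma clamp_lipschitz M a b : `|clamp M a - clamp M b| <= `|a - b|.
Proof.
wlog ab : a b / a <= b.
  by move=> H; case: (leP a b) => [/H//|/ltW/H]; rewrite distrC (distrC b).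
have cab : clamp M a <= clamp M b by rewrite le_max2// le_min2.
rewrite !ler0_norm ?subr_le0// !opprB /clamp.
by case: (leP a M) => aM; case: (leP b M) => bM;
  [case: (leP (- M) a) => Ma; case: (leP (- M) b) => Mb|
   case: (leP (- M) a) => Ma; case: (leP (- M) M) => MM| |]; lra.
Qed.

Lemma measurable_clamp d (T : measurableType d) M (g : T -> R) :
  measurable_fun setT g -> measurable_fun setT (fun x => clamp M (g x)).
Proof. by move=> mg; apply: measurable_maxr => //; exact: measurable_minr. Qed.

Lemma Lfun_infty_ae_bounded (u : R -> R) : u \in Lfun mu +oo%E ->
  exists2 M, 0 <= M & {ae mu, forall x, `|u x| <= M}.
Proof.
move=> /andP[_]; rewrite inE/= /finite_norm unlock /Lnorm.
(* The norm of exponent +oo is the essential supremum only when the whole space has positive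
   measure. *)
have -> : (0 < mu setT)%E.
  apply: (@lt_le_trans _ _ (mu `[0, 1]%classic)).
    by rewrite /= lebesgue_measure_itv/= lte01 oppr0 adde0 lte01.
  by apply: le_measure; rewrite ?inE.
move=> /ess_supr_bounded[M uM]; exists (Num.max 0 M); first by rewrite le_max lexx.
by apply: filterS uM => x /= xM; rewrite le_max xM orbT.
Qed.

End truncation.

(** * Oscillation controlled by the Slobodeckij seminorm *)

Section slobodeckij.
Context {R : realType}.
Notation mu := (@lebesgue_measure R).

Definition slobodeckij (alpha : R) (u : R -> R) (p : R * R) : R :=
  `|u p.1 - u p.2| / `|p.1 - p.2| `^ (1 + alpha).

Lemma slobodeckij_ge0 alpha u p : 0 <= slobodeckij alpha u p.
Proof. by rewrite divr_ge0// powR_ge0. Qed.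

Lemma near_diag_le_slobodeckij (alpha h : R) (u : R -> R) (x y : R) : 0 < alpha -> 0 <= h ->
  `|u x - u y| * near_diag h x y <= h `^ (1 + alpha) * slobodeckij alpha u (x, y).
Proof.
move=> a0 h0; rewrite near_diagE; case: (leP `|x - y| h) => xyh; last first.
  by rewrite mulr0 mulr_ge0 ?powR_ge0 ?slobodeckij_ge0.
rewrite mulr1 /slobodeckij/=; have [->|xy] := eqVneq x y.
  by rewrite subrr normr0 mul0r mulr0.
have xy0 : 0 < `|x - y| `^ (1 + alpha) by rewrite powR_gt0// normr_gt0 subr_eq0.
rewrite mulrCA ler_peMr// ler_pdivlMr// mul1r ge0_ler_powR ?nnegrE//.
by rewrite addr_ge0// ltW.
Qed.

(** Here the fractional regularity enters: on the strip, |x - y|^(1 + alpha) is at most h^(1 +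
    alpha). Only increments of [w] matter, so [w] may be the clamped [u]. *)
Lemma integral_osc_le (alpha M N h : R) (u w : R -> R) :
  0 < alpha -> 0 <= h -> measurable_fun setT (slobodeckij alpha u) ->
  measurable_fun setT w -> (forall x, `|w x| <= M) ->
  (forall x y, `|w x - w y| <= `|u x - u y|) ->
  (\int[mu]_x (osc w h N x)%:E <=
   (h `^ (1 + alpha))%:E * \int[(mu \x mu)]_p (slobodeckij alpha u p)%:E)%E.
Proof.
move=> a0 h0 mS mw wM wu.
under eq_integral do rewrite (EFin_osc _ _ _ mw wM).
have ms : measurable_fun setT (fun p : R * R => `|w p.1 - w p.2| * near_diag h p.1 p.2 * box N p.2).
  apply: measurable_funM; last by apply: measurableT_comp => //; exact: measurable_box.
  apply: measurable_funM; last exact: measurable_near_diag.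
  by apply: measurableT_comp => //; apply: measurable_funB; apply: measurableT_comp.
rewrite -(@tonelli_plane _ (fun p => `|w p.1 - w p.2| * near_diag h p.1 p.2 * box N p.2))//; last first.
  by move=> p; rewrite mulr_ge0 ?box_ge0// mulr_ge0// near_diagE ler0n.
rewrite -ge0_integralZl_EFin//; last 3 first.
- by move=> p _; rewrite lee_fin slobodeckij_ge0.
- exact/measurable_EFinP.
- exact: powR_ge0.
apply: ge0_le_integral => //.
- by move=> p _; rewrite lee_fin mulr_ge0 ?box_ge0// mulr_ge0// near_diagE ler0n.
- exact/measurable_EFinP.
- by apply/measurable_EFinP; exact: measurable_funM.
- move=> p _; rewrite -EFinM lee_fin.
  apply: le_trans (near_diag_le_slobodeckij u p.1 p.2 a0 h0).
  rewrite (@le_trans _ _ (`|w p.1 - w p.2| * near_diag h p.1 p.2))//.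
    rewrite ler_piMr ?mulr_ge0// ?near_diagE// ?ler0n//; rewrite boxE; by case: (_ <= N).
  by rewrite ler_wpM2r// near_diagE ler0n.
Qed.

End slobodeckij.

(** * Entropy solutions on the whole plane *)

Section entropy_solutions.
Context {R : realType}.
Notation mu := (@lebesgue_measure R).

Lemma measurable_ge0_half_plane : measurable [set p : R * R | 0 <= p.1].
Proof.
have -> : [set p : R * R | 0 <= p.1] = setT `&` fst @^-1` (`[0, +oo[%classic : set R).
  by rewrite setTI; apply/seteqP; split => p /=; rewrite in_itv/= andbT.
exact: measurable_fst.
Qed.

(** A solution is measurable only on t >= 0; the value 0 elsewhere makes it measurable on the
    plane. *)
Definition extension (u : R -> R -> R) (p : R * R) : R :=
  if 0 <= p.1 then u p.1 p.2 else 0.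

Lemma measurable_extension (u : R -> R -> R) :
  measurable_fun [set p : R * R | 0 <= p.1] (fun p => u p.1 p.2) ->
  measurable_fun setT (extension u).
Proof.
move=> /(measurable_restrictT _ measurable_ge0_half_plane).
congr (measurable_fun _ _); apply/funext => p.
by rewrite patchE /extension mem_setE.
Qed.

Lemma kruzhkov_entropy_ge0 (f w ubar : R -> R) (u : R -> R -> R) (M T d h y : R) :
  measurable_fun setT f -> measurable_fun setT w ->
  entropy_solution f ubar u ->
  {ae (mu \x mu)%E, forall p, clamp M (extension u p) = extension u p} ->
  0 < d -> d <= T -> 0 < h ->
  (0 <= \int[(mu \x mu)]_p (kruzhkov f w (dplateau T d p.1) (plateau T d p.1)
     (clamp M (extension u p)) h p.2 y)%:E)%E.
Proof.
move=> mf mw [mu0 _ _ _ ent] VU d0 dT h0.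
have := ent (w y) _ (test_function_phi y d0 dT h0).
have mU := measurable_extension mu0.
have mk (v : R * R -> R) : measurable_fun setT v ->
  measurable_fun setT (fun p : R * R => (kruzhkov f w (dplateau T d p.1) (plateau T d p.1) (v p) h p.2 y)%:E).
  move=> mv; apply/measurable_EFinP; apply: measurable_kruzhkov => //.
  - exact: (measurableT_comp (measurable_dplateau T d)).
  - exact: (measurableT_comp (measurable_plateau T d)).
rewrite integral_mkcond.
have -> : (\int[(mu \x mu)]_p (kruzhkov f w (dplateau T d p.1) (plateau T d p.1)
     (clamp M (extension u p)) h p.2 y)%:E = \int[(mu \x mu)]_p (kruzhkov f w
     (dplateau T d p.1) (plateau T d p.1) (extension u p) h p.2 y)%:E)%E.
  apply: ae_eq_integral => //; [by apply: mk; exact: measurable_clamp|exact: mk|].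
  case: VU => A [mA A0 AVU]; exists A; split => // p np.
  by apply: AVU => VUp; apply: np => _; rewrite VUp.
move=> /le_trans; apply; rewrite le_eqVlt; apply/orP; left; apply/eqP.
(* For t <= 0 the plateau and its derivative vanish, so the integral over the half-plane equals that
   over the plane. *)
apply: eq_integral => -[t x] _; rewrite patchE mem_setE/= /extension/=.
case: ifPn => t0.
  by rewrite (ltW t0) /kruzhkov dt_phi dx_phi /eflux.
have td : t <= d by rewrite (le_trans _ (ltW d0))// leNgt.
rewrite /kruzhkov plateau_eq0 ?dplateau_eq0//; [|by left..].
by rewrite !(mul0r, mulr0) addr0.
Qed.

Lemma entropy_solution_near (f ubar : R -> R) (u : R -> R -> R) (t r e : R) :
  entropy_solution f ubar u -> 0 <= t -> 0 < e ->
  exists2 d, 0 < d & forall s, 0 <= s -> `|t - s| < d ->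
    (\int[mu]_(x in `[(- r)%R, r%R]) `|u s x - u t x|%:E <= e%:E)%E.
Proof.
move=> [_ _ cu _ _] t0 e0.
have e_nbhs : nbhs (0%E : \bar R) [set y | (y < e%:E)%E].
  by apply: open_nbhs_nbhs; split; [exact: open_ereal_lt_ereal|rewrite /= lte_fin].
have := cu t r t0 _ e_nbhs.
rewrite /nbhs/= /within/= => /nbhs_ballP[d d0 dP].
by exists d => // s s0 ts; apply/ltW/dP => //=; rewrite in_itv/= s0.
Qed.

(** Monotone convergence turns a bound uniform in n into a global one, with no prior integrability
    of [g]. *)
Lemma integral_le_exhaustion (g : R -> R) (B : \bar R) : measurable_fun setT g ->
  (forall x, 0 <= g x) ->
  (forall n : nat, (\int[mu]_(x in `[(- n%:R)%R, n%:R]) (g x)%:E <= B)%E) ->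
  (\int[mu]_x (g x)%:E <= B)%E.
Proof.
move=> mg g0 gB.
pose F (n : nat) : set R := `[- n%:R, n%:R]%classic.
have FT : \bigcup_i F i = setT.
  rewrite -subTset => x _; exists (Num.truncn `|x|).+1 => //.
  by rewrite /F/= in_itv/= -ler_norml ltW// truncnS_gt.
have mF n : measurable (F n) by exact: measurable_itv.
have H : (\int[mu]_(x in F i) (g x)%:E)%E @[i --> \oo] -->
    (\int[mu]_(x in \bigcup_i F i) (g x)%:E)%E.
  apply: ge0_nondecreasing_set_cvg_integral => //.
  - move=> n m nm; apply/subsetPset => x; rewrite /F/= !in_itv/= -!ler_norml => /le_trans; apply.
    by rewrite ler_nat.
  - by move=> n; apply: measurable_funTS; exact/measurable_EFinP.
  - by move=> n x _; rewrite lee_fin.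
rewrite -FT -(cvg_lim _ H)//; apply: lime_le; first by apply/cvg_ex; eexists; exact: H.
by apply: nearW => n; exact: gB.
Qed.

End entropy_solutions.

(** * Hoelder continuity in time at t = 0 *)

Section holder_in_time.
Context {R : realType}.
Notation mu := (@lebesgue_measure R).

Lemma entropy_solution_holder (f ubar : R -> R) (u : R -> R -> R) (alpha : R) :
  is_C1 f -> 0 < alpha <= 1 -> ubar \in Lfun mu +oo%E -> W1 alpha ubar ->
  entropy_solution f ubar u ->
  exists C : R, forall T, 0 < T <= 1 ->
    (\int[mu]_x `|u T x - ubar x|%:E <= (C * T `^ alpha)%:E)%E.
Proof.
move=> f1 /andP[a0 a1] ubarI [ubar1 iS] usol.
have ae_filter : Filter (nbhs (almost_everywhere mu)).
  exact: (ae_filter_ringOfSetsType [the {measure set _ -> \bar R} of mu]).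
have mf : measurable_fun setT f.
  apply: continuous_measurable_fun => x.
  by apply/differentiable_continuous/derivable1_diffP; exact: f1.1.
have mubar : measurable_fun setT ubar.
  by apply/measurable_EFinP; apply: (measurable_int mu); exact/Lfun1_integrable.
have [M1 M10 ubarM1] := Lfun_infty_ae_bounded ubarI.
have [mu0 [M2 uM2] _ u0 _] := usol.
pose M := Num.max M1 M2.
have M0 : 0 <= M by rewrite le_max M10.
have [L L0 fL] := C1_lipschitz M f1.
pose w x := clamp M (ubar x).
have mw : measurable_fun setT w by exact: measurable_clamp.
have wM x : `|w x| <= M by exact: norm_clamp.
have wubar : {ae mu, forall x, w x = ubar x}.
  by apply: filterS ubarM1 => x ux; rewrite /w clamp_id// le_max ux.
have mU := measurable_extension mu0.
have VU : {ae (mu \x mu)%E, forall p, clamp M (extension u p) = extension u p}.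
  case: uM2 => A [mA A0 AuM]; exists A; split => // p np; apply: AuM => pM; apply: np.
  rewrite /= /extension; case: ifPn => p0; apply: clamp_id; last by rewrite normr0.
  by rewrite le_max (pM p0) orbT.
have mS : measurable_fun setT (slobodeckij alpha ubar).
  by apply/measurable_EFinP; exact: measurable_int iS.
pose W := fine (\int[(mu \x mu)]_p (slobodeckij alpha ubar p)%:E)%E.
have WE : (\int[(mu \x mu)]_p (slobodeckij alpha ubar p)%:E = W%:E)%E.
  by rewrite fineK//; exact: integrable_fin_num iS.
have W0 : 0 <= W.
  by apply: fine_ge0; apply: integral_ge0 => p _; rewrite lee_fin slobodeckij_ge0.
have mUt s : measurable_fun setT (fun x => extension u (s, x)).
  by apply: (measurableT_comp mU); exact: pair1_measurable.
have extE s x : 0 <= s -> extension u (s, x) = u s x by rewrite /extension/= => ->.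
have mut s : 0 <= s -> measurable_fun setT (u s).
  by move=> s0; have := mUt s; congr measurable_fun; apply/funext => x; rewrite extE.
(* Obtained from [local_L1_estimate] with h = T, e = T^alpha and J = T^(1 + alpha) W, followed by T
   <= T^alpha in the boundary term. *)
exists (256 + (128 + 64 * L) * W + 128 * L * M) => T /andP[T0 T1].
have Ta0 : 0 < T `^ alpha by exact: powR_gt0.
have TTa : T <= T `^ alpha.
  have T01 : 0 < T <= 1 by rewrite T0.
  by have := ger_powR T01 a1; rewrite powRr1// ltW.
have TaS : T `^ (1 + alpha) = T * T `^ alpha.
  by rewrite powRD; [rewrite powRr1// ltW|rewrite (gt_eqF T0) implybT].
have mabs (g k : R -> R) : measurable_fun setT g -> measurable_fun setT k ->
    measurable_fun setT (fun x => `|g x - k x|).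
  by move=> mg mk; apply: measurableT_comp => //; exact: measurable_funB.
have -> : (\int[mu]_x `|u T x - ubar x|%:E = \int[mu]_x `|extension u (T, x) - w x|%:E)%E.
  apply: ge0_ae_eq_integral => //.
  - by apply/measurable_EFinP; apply: mabs => //; apply: mut; exact: ltW.
  - by apply/measurable_EFinP; apply: mabs.
  - by apply: filterS wubar => x wx _; rewrite wx extE// ltW.
apply: integral_le_exhaustion => //; first exact: mabs.
move=> n.
(* With N = n + T and h = T the estimate holds on |x| <= N - h = n, while continuity in time is
   needed on |x| <= N + h = r. *)
have N0 : 0 < n%:R + T by rewrite ltr_wpDl.
pose r := n%:R + T + T.
have [d1 d10 Hd1] := entropy_solution_near r usol (lexx 0) Ta0.
have [d2 d20 Hd2] := entropy_solution_near r usol (ltW T0) Ta0.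
(* The window [d, 2d] must lie strictly within d1 of time 0, hence the 3; [T, T + d] strictly within
   d2 of T, hence the 2. *)
pose d := Num.min (Num.min (d1 / 3) (d2 / 2)) T.
have d0 : 0 < d by rewrite !lt_min T0 !divr_gt0.
have dT : d <= T by rewrite ge_min lexx orbT.
have dd1 : d <= d1 / 3 by rewrite !ge_min lexx.
have dd2 : d <= d2 / 2 by rewrite !ge_min lexx orbT.
have := @local_L1_estimate R f w (fun x => extension u (T, x)) (extension u)
  (fun p => clamp M (extension u p)) L M (n%:R + T) T d T (T `^ alpha) (T `^ (1 + alpha) * W).
rewrite addrK.
have -> : 16 / T * (8 * (2 * T * T `^ alpha + T `^ (1 + alpha) * W) +
   T * (L * (4 / T) * (T `^ (1 + alpha) * W) + L * (M + M) * (4 * T))) =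
   256 * T `^ alpha + (128 + 64 * L) * W * T `^ alpha + 128 * L * M * T.
  by rewrite TaS; field; rewrite gt_eqF.
move=> H; apply: (@le_trans _ _ (256 * T `^ alpha + (128 + 64 * L) * W * T `^ alpha +
  128 * L * M * T)%:E); last first.
  have LM0 : 0 <= 128 * L * M by apply: mulr_ge0 => //; exact: mulr_ge0.
  by rewrite lee_fin; have := ler_wpM2l LM0 TTa; lra.
apply: H => //.
- exact: measurable_clamp.
- by move=> p; exact: norm_clamp.
- exact: powR_ge0.
- by rewrite mulr_ge0// powR_ge0.
- move=> y; exact: (kruzhkov_entropy_ge0 _ mf mw usol VU d0 dT T0).
- move=> t /andP[dt td].
  have t0 : 0 <= t by rewrite (le_trans (ltW d0)).
  apply: le_trans (Hd1 t t0 _); last by rewrite sub0r normrN ger0_norm//; lra.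
  (* The value at time 0 agrees with the datum, and the datum with its clamped version, only almost
     everywhere. *)
  rewrite le_eqVlt; apply/orP; left; apply/eqP.
  apply: ge0_ae_eq_integral => //.
  + by apply/measurable_EFinP; apply: measurable_funTS; exact: mabs.
  + by apply/measurable_EFinP; apply: measurable_funTS; apply: mabs; exact: mut.
  + near=> x => _; rewrite extE//; congr (`|_ - _|%:E).
    have -> : w x = ubar x by near: x.
    by apply/esym; near: x.
- move=> t /andP[Tt tT].
  have t0 : 0 <= t by rewrite (le_trans (ltW T0)).
  apply: le_trans (Hd2 t t0 _); last by rewrite ler0_norm ?subr_le0//; lra.
  by under eq_integral do rewrite !extE ?(ltW T0)//.
- apply: le_trans (@integral_osc_le _ alpha M (n%:R + T) T ubar w a0 (ltW T0) mS mw wM _) _.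
    by move=> x y; exact: clamp_lipschitz.
  by rewrite WE -EFinM.
Unshelve. all: by end_near.
Qed.

End holder_in_time.

Unset Implicit Arguments.

Theorem proposition4p2 (R : realType) (f : R -> R)
    (S : R -> (R -> R) -> R -> R) (alpha : R) :
  is_C1 f -> solution_operator f S -> 0 < alpha <= 1 ->
  [set u : R -> R | u \in Lfun (@lebesgue_measure R) +oo%E] `&` W1 alpha
    `<=` intermediate_domain S alpha.
Proof.
move=> f1 Ssol a01 u [uI uW].
have uL : L1_Linf u by split => //; exact: uW.1.
split => //.
have [C HC] := entropy_solution_holder f1 a01 uI uW (Ssol _ uL).
apply: (@le_lt_trans _ _ C%:E); last exact: ltry.
apply: ge_ereal_sup => _ [t /= t01 <-]; have /andP[t0 t1] := t01.
rewrite Lnorm1.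
have ta0 : 0 < t `^ alpha by exact: powR_gt0.
apply: (@le_trans _ _ ((t `^ (- alpha))%:E * (C * t `^ alpha)%:E)%E).
  by rewrite lee_wpmul2l ?lee_fin ?powR_ge0//; exact: HC.
by rewrite -EFinM lee_fin mulrCA powRN mulVf ?mulr1// gt_eqF.
Qed.
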